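(* Fix integers $m\geq 2$ and $D\geq 2$. Then, up to isomorphism, there are only finitely many coconnected non-geometric distance-regular graphs with smallest eigenvalue at least $-m$ and diameter $D$.
   Context: All graphs are finite, undirected and simple. A connected graph $\Gamma$ with diameter $D$ is distance-regular if there are integers $b_i,c_i$ ($0\le i\le D$) such that for any vertices $x,y$ with $d(x,y)=i$, exactly $c_i$ neighbours of $y$ are at distance $i-1$ from $x$ and exactly $b_i$ neighbours of $y$ are at distance $i+1$ from $x$; it is then regular of valency $k=b_0$, and $a_i:=k-b_i-c_i$. The eigenvalues of a graph are those of its adjacency matrix; a distance-regular graph of diameter $D$ has exactly $D+1$ distinct eigenvalues $k=\theta_0>\theta_1>\dots>\theta_D$, and $\theta_D$ is its smallest eigenvalue. A clique is a set of pairwise adjacent vertices. A Delsarte clique in a distance-regular graph with valency $k$, diameter $D\ge 2$ and smallest eigenvalue $\theta_D$ is a clique with exactly $1+\frac{k}{-\theta_D}$ vertices. A non-complete distance-regular graph is geometric if there is a set $\mathcal C$ of Delsarte cliques such that every edge lies in exactly one member of $\mathcal C$. A graph is coconnected if its complement is connected. *)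

(* Defs.v *)
From HB Require Import structures.
From mathcomp Require Import all_boot all_order all_algebra all_field.
Set Implicit Arguments. Unset Strict Implicit. Unset Printing Implicit Defensive.
Import Order.TTheory GRing.Theory Num.Theory.

Definition simple_graph n (e : rel 'I_n) : Prop := symmetric e /\ irreflexive e.

Fixpoint walkset n (e : rel 'I_n) (k : nat) (x : 'I_n) : {set 'I_n} :=
  match k with
  | 0 => [set x]
  | k'.+1 => [set z | [exists y in walkset e k' x, e y z]]
  end.

Definition ball n (e : rel 'I_n) (k : nat) (x : 'I_n) : {set 'I_n} :=
  [set y | [exists j : 'I_k.+1, y \in walkset e j x]].

Definition dist_eq n (e : rel 'I_n) (x y : 'I_n) (i : nat) : bool :=
  (y \in ball e i x) && ((i == 0) || (y \notin ball e i.-1 x)).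

Definition connected n (e : rel 'I_n) : Prop := forall x y, connect e x y.

Definition coconnected n (e : rel 'I_n) : Prop :=
  forall x y, connect (fun u v => (u != v) && ~~ e u v) x y.

Definition diameter_is n (e : rel 'I_n) (D : nat) : Prop :=
  (exists x y, dist_eq e x y D) /\ (forall x y i, dist_eq e x y i -> i <= D).

Definition drg_diam n (e : rel 'I_n) (D : nat) : Prop :=
  connected e /\ diameter_is e D /\
  exists b c : nat -> nat, forall x y i, dist_eq e x y i ->
    (0 < i -> #|[set z | e y z & dist_eq e x z i.-1]| = c i) /\
    #|[set z | e y z & dist_eq e x z i.+1]| = b i.

Local Open Scope ring_scope.

Definition adj n (e : rel 'I_n) : 'M[algC]_n := \matrix_(i, j) (e i j)%:R.

Definition regular n (e : rel 'I_n) (k : nat) : Prop :=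
  forall x, #|[set y | e x y]| = k.

Definition smallest_eig n (e : rel 'I_n) (th : algC) : Prop :=
  eigenvalue (adj e) th /\ forall a, eigenvalue (adj e) a -> th <= a.

Definition clique n (e : rel 'I_n) (C : {set 'I_n}) : Prop :=
  forall x y, x \in C -> y \in C -> x != y -> e x y.

Definition delsarte_clique n (e : rel 'I_n) (k : nat) (th : algC) (C : {set 'I_n}) : Prop :=
  clique e C /\ (#|C|%:R = 1 + k%:R / (- th)).

(* geometric (for non-complete distance-regular graphs) *)
Definition geometric n (e : rel 'I_n) : Prop :=
  exists (k : nat) (th : algC), regular e k /\ smallest_eig e th /\
  exists Cs : {set {set 'I_n}},
    (forall C, C \in Cs -> delsarte_clique e k th C) /\
    (forall x y, e x y -> #|[set C in Cs | (x \in C) && (y \in C)]| = 1%N).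

Definition graph_iso n n' (e : rel 'I_n) (e' : rel 'I_n') : Prop :=
  exists f : 'I_n -> 'I_n', bijective f /\ forall x y, e x y = e' (f x) (f y).

(* Main.v *)
Require Import Defs.
From HB Require Import structures.
From mathcomp Require Import all_boot all_order all_algebra all_field.
From mathcomp Require Import zify ring.
From Stdlib Require List.
Import Order.TTheory GRing.Theory Num.Theory.
Local Open Scope ring_scope.

(** Let [A] be the adjacency matrix, [k] the valency and [t = m^2], an upper bound
for the size of a coclique in the neighbourhood of a vertex. It suffices to bound
[k] for non-geometric graphs.

Coconnectedness gives [k <= t k_2]. Suppose first that [c_2 >= k / Q] for a
constant [Q = Q(m)]. Then the number [n] of vertices is [O(k)], and since [tr A = 0],
[tr A^2 = n k] and all eigenvalues are at least [- m], there is an eigenvalue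
[th <> k] of order [k] with bounded multiplicity. Its idempotent has bounded rank
and at most [D + 1] distinct entries, hence boundedly many distinct columns; since
adjacent vertices have distinct columns this is a proper colouring of the graph, so
every neighbourhood is a union of boundedly many cocliques and [k] is bounded.

If [c_2 < k / Q], then [a_1] is much larger than [c_2], every neighbourhood is a
disjoint union of large cliques, and these form a partial linear space with the same
number [M] of lines on every vertex and fewer lines than vertices. With [Inc] the
incidence matrix, [Inc Inc^T = A + M], so [- M] is the smallest eigenvalue, and its
idempotent is orthogonal to every line, which forces every line to be a Delsarte
clique: the graph is geometric. *)

Set Implicit Arguments.
Unset Strict Implicit.
Unset Printing Implicit Defensive.

Lemma card_bigcup_le (I T : finType) (Q : pred I) (F : I -> {set T}) r :
  (forall i, Q i -> #|F i| <= r)%N -> (#|\bigcup_(i | Q i) F i| <= #|Q| * r)%N.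
Proof.
move=> H; rewrite -sum_nat_const.
elim/big_ind2: _ => [|X1 s1 X2 s2 le1 le2|i]; [by rewrite cards0| |exact: H].
by apply: leq_trans (leq_card_setU _ _).1 (leq_add le1 le2).
Qed.

(** * Distance-regular graphs as path metrics *)

Section PathMetric.
Local Open Scope nat_scope.

Variables (n : nat) (e : rel 'I_n).

Lemma walksetS k x z :
  (z \in walkset e k.+1 x) = [exists y, (y \in walkset e k x) && e y z].
Proof. by rewrite /= inE. Qed.

Lemma ballP i x y :
  reflect (exists2 j, j <= i & y \in walkset e j x) (y \in ball e i x).
Proof.
rewrite inE; apply: (iffP existsP) => [[j yj]|[j lji yj]].
  by exists j => //; rewrite -ltnS.
by exists (Ordinal (lji : j < i.+1)).
Qed.

Lemma mem_ball_connected : connected e -> forall x y, exists i, y \in ball e i x.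
Proof.
move=> con x y; have /connectP[p] := con x y.
elim/last_ind: p y => [|p z IH] y /=.
  by move=> _ ->; exists 0; apply/ballP; exists 0; rewrite //= inE.
rewrite rcons_path last_rcons => /andP[pp ez] ->.
have [i /ballP[j _ yj]] := IH _ pp erefl.
exists j.+1; apply/ballP; exists j.+1 => //.
by rewrite walksetS; apply/existsP; exists (last x p); rewrite yj.
Qed.

End PathMetric.

(** A distance function with local axioms only, replacing the walk-based [dist_eq]; symmetry and the
    triangle inequality are recovered from them. *)
Record drg_metric n (e : rel 'I_n) (d : 'I_n -> 'I_n -> nat) (D : nat)
    (b c : nat -> nat) : Prop := DrgMetric {
  edge_sym : symmetric e;
  edge_irr : irreflexive e;
  dist0 : forall x y, (d x y == 0%N) = (x == y);
  dist_step : forall x y z, e y z -> (d x z <= (d x y).+1)%N;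
  dist_pred : forall x y i, d x y = i.+1 -> exists2 z, e y z & d x z = i;
  dist_max : forall x y, (d x y <= D)%N;
  dist_diam : exists x y, d x y = D;
  card_pred : forall x y i, d x y = i.+1 ->
    #|[set z | e y z & d x z == i]| = c i.+1;
  card_succ : forall x y i, d x y = i ->
    #|[set z | e y z & d x z == i.+1]| = b i }.

Lemma drg_diam_metric n (e : rel 'I_n) D : simple_graph e -> drg_diam e D ->
  exists d b c, drg_metric e d D b c.
Proof.
move=> [edgeC eirr] [con [[[x0 [y0 dxy0]] dmax] [b [c dbc]]]].
pose ex x y := mem_ball_connected con x y.
pose d x y := ex_minn (ex x y).
have dP x y : y \in ball e (d x y) x by rewrite /d; case: ex_minnP.
have dmin x y i : y \in ball e i x -> (d x y <= i)%N.
  by rewrite /d; case: ex_minnP => j _ H /H.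
have dE x y i : dist_eq e x y i = (d x y == i).
  apply/andP/eqP => [[yb]|<-].
    have le := dmin _ _ _ yb; case: i yb le => [|i] _ le.
      by move=> _; apply/eqP; rewrite -leqn0.
    move=> /= nyb; apply/eqP; rewrite eqn_leq le /= ltnNge; apply: contra nyb => le'.
    have /ballP[j lj yj] := dP x y.
    by apply/ballP; exists j => //; apply: leq_trans le'.
  split; first exact: dP.
  case E: (d x y) => [//|l] /=.
  by apply/negP => /dmin; rewrite E ltnn.
have d0 x y : (d x y == 0%N) = (x == y).
  apply/idP/eqP => [/eqP E|->].
    have := dP x y; rewrite E => /ballP[j]; rewrite leqn0 => /eqP -> /=.
    by rewrite inE => /eqP.
  by rewrite -leqn0; apply: dmin; apply/ballP; exists 0%N; rewrite //= inE.
have dstep x y z : e y z -> (d x z <= (d x y).+1)%N.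
  move=> eyz; apply: dmin; have /ballP[j lj yj] := dP x y.
  apply/ballP; exists j.+1 => //.
  by rewrite walksetS; apply/existsP; exists y; rewrite yj.
exists d, b, c; split => //.
- move=> x y i E; have /ballP[[|j] lj] := dP x y.
    by rewrite /= inE => /eqP yx; move: E; rewrite yx => /eqP;
      rewrite (eqP (_ : d x x == 0%N)) // d0.
  rewrite walksetS => /existsP[z /andP[zj ezy]].
  exists z; first by rewrite edgeC.
  have le1 : (d x z <= j)%N by apply: dmin; apply/ballP; exists j.
  by have := dstep x z y ezy; move: lj; rewrite E; lia.
- by move=> x y; apply: (dmax x y); rewrite dE.
- by exists x0, y0; apply/eqP; rewrite -dE.
- move=> x y i E; have [|H _] := dbc x y i.+1; first by rewrite dE E.
  rewrite -(H isT); apply: eq_card => z; rewrite !inE /= -dE //.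
- move=> x y i E; have [|_ H] := dbc x y i; first by rewrite dE E.
  rewrite -H; apply: eq_card => z; rewrite !inE /= -dE //.
Qed.

Section Metric.
Local Open Scope nat_scope.

Variables (n : nat) (e : rel 'I_n) (d : 'I_n -> 'I_n -> nat) (D : nat).
Variables (b c : nat -> nat).
Hypothesis drg : drg_metric e d D b c.

Notation N x := [set y | e x y].
Notation k := (b 0).

Let edgeC := edge_sym drg.
Let eirr := edge_irr drg.

Lemma distxx x : d x x = 0.
Proof. by apply/eqP; rewrite (dist0 drg). Qed.

Lemma dist1 x y : (d x y == 1) = e x y.
Proof.
apply/eqP/idP => [/(dist_pred drg)[z eyz /eqP]|exy].
  by rewrite (dist0 drg) => /eqP ->; rewrite edgeC.
apply/eqP; rewrite eqn_leq lt0n (dist0 drg).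
have := dist_step drg x exy; rewrite distxx => -> /=.
by apply: contraTneq exy => ->; rewrite eirr.
Qed.

Lemma dist_triangle x y z : d x z <= d x y + d y z.
Proof.
move E: (d y z) => i; elim: i z E => [|i IH] w E.
  by move/eqP: E; rewrite (dist0 drg) => /eqP ->; rewrite addn0.
have [v ewv Ev] := dist_pred drg E.
have le1 := IH v Ev; have := @dist_step _ _ _ _ _ _ drg x v w; rewrite edgeC => /(_ ewv).
lia.
Qed.

Lemma distC x y : d x y = d y x.
Proof.
have le u v : d v u <= d u v.
  move E: (d u v) => i; elim: i v E => [|i IH] w E.
    by move/eqP: E; rewrite (dist0 drg) => /eqP ->; rewrite distxx.
  have [z ewz Ez] := dist_pred drg E.
  have := IH z Ez; have := dist_triangle w z u.
  by move: ewz; rewrite -dist1 => /eqP ->; lia.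
by apply/eqP; rewrite eqn_leq !le.
Qed.

Lemma dist_attained i : i <= D -> exists x y, d x y = i.
Proof.
move=> lei; have [x [y E]] := dist_diam drg.
move El: (D - i) => j; elim: j i lei El => [|j IH] l ll El.
  by exists x, y; lia.
have [||u [v]] := IH l.+1; try lia.
by move=> /(dist_pred drg)[z _ Ez]; exists u, z.
Qed.

Lemma valency x : #|N x| = k.
Proof.
rewrite -(card_succ drg (distxx x)); apply: eq_card => y.
by rewrite !inE dist1 andbb.
Qed.

(** Testing [(d x z).+1 == i] instead of [d x z == i.-1] makes the set empty at [i = 0], where the
    predecessor would truncate to 0. *)
Lemma inter_pred (x y : 'I_n) i : d x y = i ->
  #|[set z | e y z & (d x z).+1 == i]| = (if i is _.+1 then c i else 0).
Proof.
case: i => [|i] E; last by rewrite -(card_pred drg E).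
by apply: eq_card0 => z; rewrite !inE andbF.
Qed.

(* The intersection number [a_i] is [k - b_i - c_i], with [c_0] read as 0. *)
Definition inter_a i := k - b i - (if i is _.+1 then c i else 0).

Lemma sphere_split (x y : 'I_n) : let i := d x y in
  k = #|[set z | e y z & (d x z).+1 == i]| + #|[set z | e y z & d x z == i]|
      + #|[set z | e y z & d x z == i.+1]|.
Proof.
move=> i; rewrite -(valency y) -(cardsID [set z | (d x z).+1 == i] (N y)).
rewrite -addnA; congr (_ + _); first by apply: eq_card => z; rewrite !inE andbC.
rewrite -(cardsID [set z | d x z == i] (_ :\: _)); congr (_ + _);
  apply: eq_card => z; rewrite !inE.
  by case: (e y z); rewrite ?andbF ?andbT //=; case: (d x z =P i) => [->|]; lia.
case eyz: (e y z); rewrite ?andbF ?andbT //=.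
have := dist_step drg x eyz; rewrite edgeC in eyz; have := dist_step drg x eyz.
rewrite /i; lia.
Qed.

Lemma inter_eq (x y : 'I_n) i : d x y = i ->
  #|[set z | e y z & d x z == i]| = inter_a i.
Proof.
move=> E; have := sphere_split x y; rewrite /= E.
rewrite (inter_pred E) (card_succ drg E) /inter_a; lia.
Qed.

Lemma common_edge x y : e x y -> #|N x :&: N y| = inter_a 1.
Proof.
move=> exy; have E : d x y = 1 by apply/eqP; rewrite dist1.
by rewrite -(inter_eq E); apply: eq_card => z; rewrite !inE dist1 andbC.
Qed.

Lemma common_dist2 x y : d x y = 2 -> #|N x :&: N y| = c 2.
Proof.
move=> E; rewrite -(card_pred drg E); apply: eq_card => z.
by rewrite !inE dist1 andbC.
Qed.

Lemma dist_eq2 x y z : e z x -> e z y -> x != y -> ~~ e x y -> d x y = 2.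
Proof.
move=> ezx ezy nxy nexy; have := dist_triangle x z y.
move: nxy nexy ezx ezy; rewrite -(dist0 drg) -!dist1 (distC x z); lia.
Qed.

Lemma c2_gt0 : 1 < D -> 0 < c 2.
Proof.
move=> D2; have [x [y E]] := dist_attained D2.
rewrite -(card_pred drg E) card_gt0; apply/set0Pn.
by have [z eyz /eqP Ez] := dist_pred drg E; exists z; rewrite inE eyz.
Qed.

(** This is k = a_1 + b_1 + c_1, with c_1 = 1 because x is the only vertex at distance 0 from x. *)
Lemma k_inter1 : 1 < D -> k = (inter_a 1 + b 1).+1.
Proof.
move=> D2; have [x [y E]] := dist_attained (ltnW D2).
have := sphere_split x y; rewrite /= E (inter_eq E) (card_succ drg E) => ->.
suff -> : #|[set z | e y z & (d x z).+1 == 1]| = 1 by [].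
rewrite -[RHS](cards1 x); apply: eq_card => z; rewrite !inE eqSS (dist0 drg) eq_sym.
by case: (z =P x) => [->|]; rewrite ?andbF ?andbT // edgeC -dist1 E.
Qed.

Notation sphere x i := [set y | d x y == i].

(** Double counting of the edges between consecutive spheres. *)
Lemma sphere_count x i :
  #|sphere x i.+1| * c i.+1 = #|sphere x i| * b i.
Proof.
transitivity (\sum_(y in sphere x i.+1) \sum_(z in sphere x i) (e y z : nat)).
  rewrite -sum_nat_const; apply: eq_bigr => y; rewrite inE => /eqP E.
  rewrite -(card_pred drg E) -sum1_card big_mkcond [RHS]big_mkcond.
  by apply: eq_bigr => z _; rewrite !inE; case: (e y z); case: (_ == i).
rewrite exchange_big /= -sum_nat_const; apply: eq_bigr => z; rewrite inE => /eqP E.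
rewrite -(card_succ drg E) -sum1_card big_mkcond [RHS]big_mkcond.
by apply: eq_bigr => y _; rewrite !inE edgeC; case: (e z y); case: (_ == i.+1).
Qed.

(** On a geodesic from x to y take w at distance 2 from y: every common neighbour of w and y is a
    neighbour of y at distance i from x. *)
Lemma c2_le i : 0 < i -> (exists x y, d x y = i.+1) -> c 2 <= c i.+1.
Proof.
move=> i0 [x [y E]].
have [w dwx dwy] : exists2 w, d x w = i.-1 & d w y = 2.
  have [z eyz Ez] := dist_pred drg E.
  have Ez' : d x z = i.-1.+1 by lia.
  have [w ezw Ew] := dist_pred drg Ez'; exists w => //.
  apply: (@dist_eq2 _ _ z) => //; [by rewrite edgeC| |].
    by apply/eqP => wy; move: Ew; rewrite wy E; lia.
  by apply/negP => /(dist_step drg x); rewrite E Ew; lia.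
rewrite -(card_pred drg dwy) -(card_pred drg E); apply: subset_leq_card.
apply/subsetP => z; rewrite !inE dist1 => /andP[eyz ewz]; rewrite eyz /=.
have := dist_step drg x ewz; rewrite dwx.
move: eyz; rewrite edgeC => /(dist_step drg x); rewrite E; lia.
Qed.

Lemma b_le_k i : i <= D -> b i <= k.
Proof.
move=> /dist_attained[x [y E]]; rewrite -(card_succ drg E) -(valency y).
by apply: subset_leq_card; apply/subsetP => z; rewrite !inE => /andP[].
Qed.

Lemma sphere0 x : #|sphere x 0| = 1.
Proof.
by rewrite -(cards1 x); apply: eq_card => z; rewrite !inE (dist0 drg) eq_sym.
Qed.

Lemma sphere1 x : #|sphere x 1| = k.
Proof. by rewrite -(valency x); apply: eq_card => z; rewrite !inE dist1. Qed.

(** From the first sphere on, each step multiplies the size by b_j / c_(j+1) <= k / c_2 <= Q. *)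
Lemma sphere_le Q x i : k <= Q * c 2 -> #|sphere x i.+1| <= k * Q ^ i.
Proof.
move=> kQ; elim: i => [|i IH]; first by rewrite sphere1 muln1.
have [->|/set0Pn[y]] := eqVneq (sphere x i.+2) set0; first by rewrite cards0.
rewrite inE => /eqP E; have c2 := @c2_le i.+1 isT (ex_intro _ x (ex_intro _ y E)).
have iD : i.+2 <= D by rewrite -E (dist_max drg).
have c20 : 0 < c 2 by apply: c2_gt0; lia.
have := sphere_count x i.+1; have := @b_le_k i.+1 (ltnW iD).
move: IH; rewrite expnS.
set S1 := #|sphere x i.+1|; set S2 := #|sphere x i.+2| => IH bk SE.
have H : S2 * c 2 <= S1 * (Q * c 2).
  apply: leq_trans (_ : S2 * c i.+2 <= _); first by rewrite leq_mul2l c2 orbT.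
  by rewrite SE leq_mul2l (leq_trans bk) ?orbT.
have {H}: S2 <= S1 * Q by rewrite -(leq_pmul2r c20) -mulnA.
by move/leq_trans; apply; rewrite mulnCA mulnC leq_mul2l IH orbT.
Qed.

Lemma card_spheres x : n = \sum_(i < D.+1) #|sphere x i|.
Proof.
rewrite -[LHS]card_ord -sum1_card.
rewrite (partition_big (fun y => inord (d x y) : 'I_D.+1) predT) //=.
apply: eq_bigr => i _; rewrite -sum1_card; apply: eq_bigl => y.
rewrite !inE; apply/eqP/eqP => [<-|->]; last by rewrite inord_val.
by rewrite inordK // ltnS (dist_max drg).
Qed.

Lemma card_le_valency Q : 0 < k -> 0 < Q -> k <= Q * c 2 ->
  n <= D.+1 * Q ^ D * k.
Proof.
move=> k0 Q0 kQ; have [x _] := dist_diam drg.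
rewrite {1}(card_spheres x) -[X in _ <= X * _ * _](card_ord D.+1) -sum1_card.
rewrite -mulnA big_distrl leq_sum //= => -[[|i] ilt] _ /=; rewrite mul1n.
  by rewrite sphere0 muln_gt0 expn_gt0 Q0.
apply: leq_trans (sphere_le _ _ kQ) _.
by rewrite mulnC leq_mul2r leq_pexp2l ?orbT // ltnW.
Qed.

(** A ball grows by a factor of at most K + 1 per unit of radius, so a bound on the valency bounds
    the number of vertices. *)
Lemma card_le_pow K : k <= K -> n <= K.+1 ^ D.
Proof.
move=> kK; have [x _] := dist_diam drg.
suff H i : #|[set y | d x y <= i]| <= K.+1 ^ i.
  rewrite -{1}[n]card_ord -cardsT; apply: leq_trans (H D).
  by apply: subset_leq_card; apply/subsetP => y; rewrite inE (dist_max drg).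
elim: i => [|i IH].
  rewrite expn0 -(sphere0 x); apply: subset_leq_card; apply/subsetP => y.
  by rewrite !inE leqn0.
apply: leq_trans (_ : #|\bigcup_(z in [set y | d x y <= i]) (z |: N z)| <= _).
  apply: subset_leq_card; apply/subsetP => y; rewrite inE.
  rewrite leq_eqVlt => /orP[/eqP E|lt].
    have [z eyz Ez] := dist_pred drg E.
    by apply/bigcupP; exists z; rewrite !inE ?Ez // edgeC eyz orbT.
  by apply/bigcupP; exists y; rewrite !inE ?eqxx.
rewrite expnS mulnC; apply: leq_trans (card_bigcup_le (r := K.+1) _) _ => [z _|].
  by rewrite cardsU1 (valency z); case: (_ \notin _); lia.
by rewrite leq_mul2r IH orbT.
Qed.

End Metric.

(** * The spectrum of the adjacency matrix *)

Section Spectrum.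

Variables (n : nat) (e : rel 'I_n.+1).
Hypothesis edgeC : symmetric e.

Local Notation A := (adj e).
Local Notation P := (spectralmx A).
Local Notation s := (spectral_diag A).

Lemma trmx_adj : A^T = A.
Proof. by apply/matrixP => x y; rewrite !mxE edgeC. Qed.

Lemma map_conj_adj : map_mx Num.conj A = A.
Proof. by apply/matrixP => x y; rewrite !mxE conjC_nat. Qed.

Lemma adj_spectral : A = invmx P *m diag_mx s *m P.
Proof.
apply/orthomx_spectralP/normalmxP.
by rewrite trmx_adj map_conj_adj.
Qed.

Lemma spectral_adj : P *m A = diag_mx s *m P.
Proof. by rewrite [X in _ *m X]adj_spectral !mulmxA mulmxV ?spectral_unit ?mul1mx. Qed.

Lemma eigenvalue_spectral i : eigenvalue A (s 0 i).
Proof.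
apply/eigenvalueP; exists (row i P).
  by rewrite -row_mul spectral_adj row_mul row_diag_mx -scalemxAl -rowE.
apply: contraTneq (spectral_unit A) => E.
have : row_free P by rewrite row_free_unit spectral_unit.
move/row_free_inj => /(_ 1%N (delta_mx 0 i) 0).
rewrite mul0mx -rowE E => /(_ erefl)/matrixP/(_ 0 i).
by rewrite !mxE !eqxx => /eqP; rewrite oner_eq0.
Qed.

Lemma horner_spectral (q : {poly algC}) :
  horner_mx A q = invmx P *m diag_mx (map_mx (horner q) s) *m P.
Proof.
by rewrite {1}adj_spectral horner_mx_uconjC ?spectral_unit // horner_mx_diag.
Qed.

Lemma trace_spectral (q : {poly algC}) :
  \tr (horner_mx A q) = \sum_i q.[s 0 i].
Proof.
rewrite horner_spectral mxtrace_mulC mulmxA mulmxV ?spectral_unit // mul1mx.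
by rewrite mxtrace_diag; apply: eq_bigr => i _; rewrite mxE.
Qed.

Lemma horner_spectral_inj (q r : {poly algC}) :
  (forall i, q.[s 0 i] = r.[s 0 i]) -> horner_mx A q = horner_mx A r.
Proof.
move=> E; rewrite !horner_spectral; congr (_ *m diag_mx _ *m _).
by apply/rowP => i; rewrite !mxE E.
Qed.

Lemma horner_eq_spectral (q r : {poly algC}) i :
  horner_mx A q = horner_mx A r -> q.[s 0 i] = r.[s 0 i].
Proof.
rewrite !horner_spectral => /(congr1 (fun X => P *m X *m invmx P)).
rewrite !mulmxA mulmxV ?spectral_unit // !mul1mx !mulmxK ?spectral_unit //.
by move/matrixP/(_ i i); rewrite !mxE eqxx.
Qed.

(** Lagrange interpolation on the spectrum. The product runs over indices, so a repeated eigenvalue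
    repeats its factor, which is harmless as each factor is 1 at [th]. Evaluated at A, the
    polynomial gives the projection onto the eigenspace of [th]. *)
Lemma indicator_poly (th : algC) :
  exists q : {poly algC}, forall i, q.[s 0 i] = (s 0 i == th)%:R.
Proof.
exists (\prod_(i | s 0 i != th) ((th - s 0 i)^-1 *: ('X - (s 0 i)%:P))) => i.
rewrite horner_prod; case: (s 0 i =P th) => [E|/eqP E].
  rewrite big1 // => j nj; rewrite E !hornerE mulVf //.
  by rewrite subr_eq0 eq_sym.
by rewrite (bigD1 i) //= !hornerE subrr mulr0 mul0r.
Qed.

Lemma rank_spectral (th : algC) (q : {poly algC}) :
    (forall i, q.[s 0 i] = (s 0 i == th)%:R) ->
  (\rank (horner_mx A q) <= #|[pred i | s 0%R i == th]|)%N.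
Proof.
move=> qs; rewrite horner_spectral.
apply: leq_trans (mxrankM_maxl _ _) (leq_trans (mxrankM_maxr _ _) _).
have -> : diag_mx (map_mx (horner q) s) =
    \sum_(i | s 0 i == th) (delta_mx i i : 'M[algC]_n.+1).
  apply/matrixP => x y; rewrite summxE !mxE qs.
  have [<-|nxy] := eqVneq x y; last first.
    rewrite mulr0n big1 // => i _; rewrite mxE.
    by case: eqP => //= <-; rewrite eq_sym (negPf nxy).
  rewrite mulr1n; case: (s 0 x =P th) => [E|/eqP E].
    rewrite (bigD1 x) ?E ?eqxx //= mxE !eqxx big1 ?addr0 // => i /andP[_ ni].
    by rewrite mxE eq_sym (negPf ni).
  rewrite big1 // => i Ei; rewrite mxE; case: eqP => //= xi.
  by rewrite xi Ei in E.
rewrite -sum1_card; elim/big_ind2: _ => [|X1 s1 X2 s2 le1 le2|i _].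
- by rewrite mxrank0.
- by apply: leq_trans (mxrank_add _ _) (leq_add le1 le2).
- by rewrite mxrank_delta.
Qed.

(** Entrywise form of w (A + m) w^* >= 0: in the orthonormal eigenbasis it is the sum of the (s_i +
    m) |u_i|^2. *)
Lemma psd_spectral (m : algC) (w : 'rV[algC]_n.+1) :
    (forall a, eigenvalue A a -> - m <= a) ->
  0 <= \sum_z (\sum_y w 0 y * A y z + m * w 0 z) * (w 0 z)^*.
Proof.
move=> em.
have -> : \sum_z (\sum_y w 0 y * A y z + m * w 0 z) * (w 0 z)^* =
    ((w *m A + m *: w) *m (map_mx Num.conj w)^T) 0 0.
  rewrite [RHS]mxE; apply: eq_bigr => z _; rewrite !mxE.
  by congr ((_ + _) * _); apply: eq_bigr.
have [u wE] : exists u, w = u *m P.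
  by exists (w *m invmx P); rewrite mulmxKV ?spectral_unit.
have uE : (map_mx Num.conj w)^T = invmx P *m (map_mx Num.conj u)^T.
  by rewrite {1}wE map_mxM trmx_mul invmx_unitary ?spectral_unitarymx // ?map_trmx.
rewrite uE {1 2}wE -mulmxA spectral_adj !mulmxA.
rewrite scalemxAl -mulmxDl mulmxK ?spectral_unit // mxE.
apply: sumr_ge0 => i _; rewrite !mxE (bigD1 i) //= big1 => [|l nl]; last first.
  by rewrite mxE (negPf nl) mulr0n mulr0.
rewrite mxE eqxx mulr1n addr0 mulrC mulrDr mulrA [_ * (m * _)]mulrCA.
rewrite [_ * u 0 i]mulrC -normCK [_ * s 0 i]mulrC -mulrDl mulr_ge0 ?exprn_ge0 //.
by rewrite addrC -[m]opprK addrC subr_ge0 em ?eigenvalue_spectral.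
Qed.

(* The star [K_(1,t)] has smallest eigenvalue [- sqrt t]; the test vector is
   [-t] at the centre and [m] at the leaves. *)
Lemma coclique_le (m : nat) (x : 'I_n.+1) (S : {set 'I_n.+1}) :
    (0 < m)%N -> irreflexive e -> (forall a, eigenvalue A a -> - m%:R <= a) ->
    {in S, forall y, e x y} -> {in S &, forall y z, ~~ e y z} ->
  (#|S| <= m ^ 2)%N.
Proof.
move=> m0 eirr em SN Sco; set t := #|S|.
have [->//|t0] := posnP t.
pose w : 'rV[algC]_n.+1 :=
  \row_y (m%:R * (y \in S)%:R - t%:R * (y == x)%:R).
have xS : x \notin S by apply: contraFN (eirr x) => /SN.
have wx : w 0 x = - t%:R by rewrite mxE eqxx (negPf xS) mulr0 sub0r mulr1.
have wS y : y \in S -> w 0 y = m%:R.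
  move=> yS; rewrite mxE yS; case: (y =P x) => [yx|_]; last by rewrite mulr0 subr0 mulr1.
  by rewrite yx (negPf xS) in yS.
have wO y : y != x -> y \notin S -> w 0 y = 0.
  by move=> yx yS; rewrite mxE (negPf yx) (negPf yS) !mulr0 subr0.
have wA z : \sum_y w 0 y * A y z =
    m%:R * (\sum_(y in S) (e y z)%:R) - t%:R * (e x z)%:R.
  transitivity (\sum_y (m%:R * ((y \in S)%:R * (e y z)%:R)
      - t%:R * ((y == x)%:R * (e y z)%:R)) : algC).
    by apply: eq_bigr => y _; rewrite !mxE mulrBl !mulrA.
  rewrite sumrB -!mulr_sumr; congr (_ * _ - _ * _).
    by rewrite [RHS]big_mkcond; apply: eq_bigr => y _; case: ifP; rewrite ?mul1r ?mul0r.
  by rewrite (bigD1 x) //= eqxx mul1r big1 ?addr0 // => y /negPf ->; rewrite mul0r.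
have wAx : \sum_y w 0 y * A y x = m%:R * t%:R.
  rewrite wA eirr mulr0 subr0; congr (_ * _).
  rewrite -[t]sum1_card natr_sum; apply: eq_bigr => y yS.
  by rewrite edgeC SN.
have wAS z : z \in S -> \sum_y w 0 y * A y z = - t%:R.
  move=> zS; rewrite wA SN // mulr1 big1 ?mulr0 ?sub0r // => y yS.
  by rewrite (negPf (Sco _ _ _ _)).
have := psd_spectral w em.
rewrite (bigD1 x) //= wAx wx (bigID (mem S)) /=.
rewrite [X in _ + (_ + X)]big1 => [|z /andP[zx zS]]; last first.
  by rewrite wO // conjC0 mulr0.
rewrite addr0 (eq_bigl (mem S)) => [|z]; last first.
  by rewrite /=; case: (z =P x) => [->|_] //; rewrite (negPf xS).
rewrite (eq_bigr (fun=> (- t%:R + m%:R * m%:R) * m%:R)) => [|z zS]; last first.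
  by rewrite wAS // wS // conjC_nat.
rewrite sumr_const -/t -[X in _ + X]mulr_natr rmorphN /= conjC_nat.
(* The centre contributes 0 and the leaves contribute m t (m^2 - t), so nonnegativity says t <=
   m^2. *)
have -> : (m%:R * t%:R + m%:R * - t%:R) * - t%:R +
    (- t%:R + m%:R * m%:R) * m%:R * t%:R =
    (m * t)%:R * ((m ^ 2)%:R - t%:R) :> algC by rewrite natrX natrM; ring.
by rewrite pmulr_rge0 ?ltr0n ?muln_gt0 ?m0 // subr_ge0 ler_nat.
Qed.

End Spectrum.

(** * Idempotents are radial *)

Section BoseMesner.

Variables (n : nat) (e : rel 'I_n.+1) (d : 'I_n.+1 -> 'I_n.+1 -> nat).
Variables (D : nat) (b c : nat -> nat).
Hypothesis drg : drg_metric e d D b c.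

Local Notation A := (adj e).
Local Notation s := (spectral_diag A).
Local Notation k := (b 0%N).
Let edgeC := edge_sym drg.
Let eirr := edge_irr drg.

Lemma sum_edges (V : 'I_n.+1 -> algC) y :
  \sum_z V z * A z y = \sum_(z | e y z) V z.
Proof.
rewrite [RHS]big_mkcond; apply: eq_bigr => z _; rewrite mxE edgeC.
by case: (e y z); rewrite ?mulr1 ?mulr0.
Qed.

(** A acts on radial functions through the tridiagonal intersection matrix. At [i = 0] the truncated
    index [i.-1] carries the coefficient 0. *)
Lemma sum_dist_nbr (h : nat -> algC) x y i : d x y = i ->
  \sum_(z | e y z) h (d x z) =
    (if i is _.+1 then (c i)%:R else 0) * h i.-1
    + (inter_a b c i)%:R * h i + (b i)%:R * h i.+1.
Proof.
move=> E.
have cardE (Q : pred 'I_n.+1) :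
    (#|[set z | e y z & Q z]|%:R : algC) = \sum_(z | e y z) (Q z)%:R.
  rewrite -sum1_card natr_sum [RHS]big_mkcond [LHS]big_mkcond; apply: eq_bigr => z _.
  by rewrite inE; case: (e y z); case: (Q z).
have -> : (if i is _.+1 then (c i)%:R else 0 : algC) =
    \sum_(z | e y z) ((d x z).+1 == i)%:R.
  by rewrite -cardE (inter_pred drg E); case: (i).
rewrite -(inter_eq drg E) -(card_succ drg E) !cardE !mulr_suml -!big_split /=.
apply: eq_bigr => z eyz.
have le1 := dist_step drg x eyz.
have le2 : (d x y <= (d x z).+1)%N by apply: (dist_step drg); rewrite edgeC.
rewrite E in le1 le2.
have : [|| (d x z).+1 == i, d x z == i | d x z == i.+1]%N.
  by apply/or3P; case: (ltngtP (d x z) i) => H; [apply: Or31|apply: Or33|apply: Or32];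
    lia.
case/or3P=> /eqP H.
- by rewrite -H !eqxx -[(d x z == _)]negbK; rewrite !ltn_eqF //= !mul0r !addr0 mul1r.
- by rewrite H eqxx gtn_eqF // ltn_eqF // !mul0r add0r addr0 mul1r.
- by rewrite H eqxx !gtn_eqF // !mul0r !add0r mul1r.
Qed.

(** Multiplication by A preserves radial matrices, so the Horner scheme stays among them. *)
Lemma horner_adj_dist (q : {poly algC}) :
  exists h : nat -> algC, forall x y, horner_mx A q x y = h (d x y).
Proof.
elim/poly_ind: q => [|q a [h hE]].
  by exists (fun=> 0) => x y; rewrite rmorph0 mxE.
exists (fun i => (if i is _.+1 then (c i)%:R else 0) * h i.-1
    + (inter_a b c i)%:R * h i + (b i)%:R * h i.+1 + a *+ (i == 0%N)) => x y.
rewrite rmorphD rmorphM /= horner_mx_X horner_mx_C !mxE (dist0 drg).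
congr (_ + _); rewrite -(@sum_dist_nbr h x y) // -sum_edges.
by apply: eq_bigr => z _; rewrite hE.
Qed.

Lemma b_gt0 i : (i < D)%N -> (0 < b i)%N.
Proof.
move=> /(dist_attained drg)[x [y E]]; have [z eyz Ez] := dist_pred drg E.
rewrite -(card_succ drg Ez) card_gt0; apply/set0Pn; exists y.
by rewrite inE edgeC eyz E eqxx.
Qed.

Lemma inter_a0 : inter_a b c 0 = 0%N.
Proof. by rewrite /inter_a subnn. Qed.

(* The three-term recurrence determines a radial eigenmatrix by its diagonal. *)
Lemma radial_eigen_eq0 (F : 'M[algC]_n.+1) (h : nat -> algC) (th : algC) :
    (forall x y, F x y = h (d x y)) -> F *m A = th *: F -> h 0%N = 0 ->
  F = 0.
Proof.
move=> FE FA h0.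
suff H i : (i <= D)%N -> h i = 0.
  by apply/matrixP => x y; rewrite FE H ?mxE // (dist_max drg).
elim/ltn_ind: i => -[//|i] IH iD.
have [x [y E]] := dist_attained drg iD; have [z eyz Ez] := dist_pred drg E.
have /matrixP/(_ x z) := FA; rewrite !mxE FE Ez IH //; last exact: ltnW.
rewrite sum_edges (eq_bigr (fun v => h (d x v))) => [|v _]; last by rewrite FE.
rewrite (sum_dist_nbr h Ez) (IH i) //; last exact: ltnW.
rewrite (_ : _ * h i.-1 = 0) ?mulr0 ?add0r => [/eqP|]; last first.
  case: (i) IH iD => [|j] IH iD; first by rewrite mul0r.
  by rewrite /= IH ?mulr0 //; lia.
by rewrite mulf_eq0 pnatr_eq0 eqn0Ngt b_gt0 // => /eqP.
Qed.

(** E is the spectral projection q(A), with q the indicator of [th] on the spectrum. Its diagonal is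
    nonzero: otherwise [radial_eigen_eq0] would give E = 0, although q is 1 at [th]. *)
Lemma idempotent_radial (i : 'I_n.+1) : let th := s 0 i in
  exists (E : 'M[algC]_n.+1) (h : nat -> algC),
    [/\ forall x y, E x y = h (d x y),
        E *m A = th *: E,
        h 0%N != 0,
        (\rank E <= #|[pred j | s 0%R j == th]|)%N &
        \tr E = #|[pred j | s 0%R j == th]|%:R /\ E *m E = E ].
Proof.
move=> th; have [q qs] := indicator_poly e th.
have [h hE] := horner_adj_dist q.
have EA : horner_mx A q *m A = th *: horner_mx A q.
  rewrite -{2}[A]horner_mx_X -linearZ /= -[LHS]/(_ * _) -rmorphM.
  apply: horner_spectral_inj => // j; rewrite !hornerE qs.
  by case: eqP => [->|]; rewrite ?mul0r ?mulr0 // mulrC.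
exists (horner_mx A q), h; split=> //.
- apply/eqP => h0; have := radial_eigen_eq0 hE EA h0.
  rewrite -(rmorph0 (horner_mx A)) => /(horner_eq_spectral edgeC i)/eqP.
  by rewrite qs eqxx horner0 oner_eq0.
- exact: rank_spectral.
split.
  rewrite trace_spectral // -sum1_card natr_sum [RHS]big_mkcond.
  by apply: eq_bigr => j _; rewrite qs inE; case: eqP.
rewrite -[LHS]/(_ * _) -rmorphM; apply: horner_spectral_inj => // j.
by rewrite hornerM qs; case: eqP; rewrite ?mulr1 ?mulr0.
Qed.

(** Compares diagonal entries of F A = th F. If th differs from k and h 0 is nonzero, then h 1
    differs from h 0. *)
Lemma radial_eigen1 (F : 'M[algC]_n.+1) (h : nat -> algC) (th : algC) :
    (forall x y, F x y = h (d x y)) -> F *m A = th *: F ->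
  k%:R * h 1%N = th * h 0%N.
Proof.
move=> FE /matrixP/(_ ord0 ord0); rewrite !mxE FE (distxx drg) => <-.
rewrite sum_edges (eq_bigr (fun v => h (d ord0 v))) => [|v _]; last by rewrite FE.
by rewrite (sum_dist_nbr h (distxx drg ord0)) inter_a0 !mul0r !add0r.
Qed.

(** The constant matrix with the diagonal of E is also a radial eigenmatrix for k, so E is constant.
    Then E E = E gives n h(0) = 1 with n the number of vertices, and the multiplicity tr E is 1. *)
Lemma valency_eigenvalue_mult : (#|[pred j | s 0%R j == k%:R]| <= 1)%N.
Proof.
have [->//|/card_gt0P[i]] := posnP #|[pred j | s 0%R j == k%:R]|.
rewrite inE => /eqP Ei; have [E [h [hE EA h0 _ [trE EE]]]] := idempotent_radial i.
rewrite Ei in EA trE.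
have JE : E = const_mx (h 0%N).
  apply/eqP; rewrite -subr_eq0; apply/eqP.
  apply: (@radial_eigen_eq0 _ (fun i => h i - h 0%N) k%:R) => [x y||].
  - by rewrite !mxE hE.
  - rewrite mulmxBl EA scalerBr; congr (_ - _); apply/matrixP => x y.
    rewrite !mxE (eq_bigr (fun z => h 0%N * A z y)) => [|z _]; last by rewrite mxE.
    rewrite sum_edges sumr_const -(valency drg y) -[LHS]mulr_natl; congr (_%:R * _).
    by apply: eq_card => z; rewrite inE.
  - by rewrite subrr.
have /matrixP/(_ ord0 ord0) := EE; rewrite JE !mxE.
rewrite (eq_bigr (fun=> h 0%N * h 0%N)) => [|z _]; last by rewrite !mxE.
rewrite sumr_const card_ord -[LHS]mulr_natl mulrA => /(canRL (mulfK h0)).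
rewrite mulfV // => nh.
move: trE; rewrite JE /mxtrace (eq_bigr (fun=> h 0%N)) => [|z _]; last by rewrite !mxE.
by rewrite sumr_const card_ord -[LHS]mulr_natl nh => /esym/eqP;
  rewrite pnatr_eq1 => /eqP ->.
Qed.

Lemma sum_spectral : \sum_i s 0 i = 0.
Proof.
have := trace_spectral edgeC 'X; rewrite horner_mx_X /mxtrace.
rewrite big1 => [E|i _]; last by rewrite mxE eirr.
by rewrite [RHS]E; apply: eq_bigr => i _; rewrite hornerX.
Qed.

Lemma sum_spectral_sqr : \sum_i s 0 i ^+ 2 = (n.+1 * k)%:R.
Proof.
have := trace_spectral edgeC 'X^2; rewrite rmorphXn /= horner_mx_X /mxtrace.
rewrite (eq_bigr (fun=> k%:R)) => [E|i _].
  rewrite (eq_bigr (horner 'X^2 \o s 0)) => [|i _]; last by rewrite /= hornerXn.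
  by rewrite -E sumr_const card_ord natrM mulr_natl.
rewrite expr2 mxE -(valency drg i) -sum1_card natr_sum [RHS]big_mkcond.
by apply: eq_bigr => z _; rewrite !mxE inE edgeC; case: (e z i); rewrite ?mulr1 ?mulr0.
Qed.

End BoseMesner.

(** * Large [c_2] bounds the valency *)

Section LargeC2.

Variables (n : nat) (e : rel 'I_n.+1) (d : 'I_n.+1 -> 'I_n.+1 -> nat).
Variables (D : nat) (b c : nat -> nat) (m : nat).
Hypothesis drg : drg_metric e d D b c.
Hypothesis m_gt0 : (0 < m)%N.
Hypothesis eig_ge : forall a : algC, eigenvalue (adj e) a -> - m%:R <= a.

Local Notation A := (adj e).
Local Notation s := (spectral_diag A).
Local Notation k := (b 0%N).
Let edgeC := edge_sym drg.
Let eirr := edge_irr drg.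

Lemma spectral_ge i : 0 <= s 0 i + m%:R.
Proof. by rewrite -[m%:R]opprK subr_ge0 eig_ge ?eigenvalue_spectral. Qed.

Lemma spectral_real i : s 0 i \is Num.real.
Proof.
by rewrite -[s 0 i](addrK m%:R) rpredB ?realn // ger0_real ?spectral_ge.
Qed.

(* Otherwise [(th + m) (k - P th) >= 0] for all eigenvalues [th <> k]; summing
   over the spectrum, with [tr A = 0] and [tr A^2 = n k], bounds [k]. *)
Lemma exists_large_eigenvalue : let P := (2 * m * (m ^ 2 + 1))%N in
    (P < k)%N -> ((m ^ 2 + 1) * k <= m ^ 2 * n.+1)%N ->
  exists2 i, s 0 i != k%:R & k%:R <= P%:R * s 0 i.
Proof.
move=> P Pk nk.
suff: [exists i, (s 0%R i != k%:R) && (k%:R <= P%:R * s 0%R i)].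
  by case/existsP => i /andP[]; exists i.
apply: contraT; rewrite negb_exists => /forallP small.
have P0 : (0 < P)%N by rewrite /P; nia.
(* The last summand is the defect P k^2 - (k - P m) k - m k = (P - 1) k (k + m) at the eigenvalue k,
   which occurs at most once. *)
have bound i : P%:R * s 0 i ^+ 2 <= (k%:R - P%:R * m%:R) * s 0 i + m%:R * k%:R
    + (s 0 i == k%:R)%:R * ((P.-1 * k * (k + m))%:R).
  have [->|nk'] := eqVneq (s 0 i) k%:R.
    rewrite mul1r le_eqVlt; apply/orP; left; apply/eqP.
    rewrite -{1 2}(prednK P0) -{2}(prednK P0) !natrM natrD -natr1; ring.
  rewrite mul0r addr0 -subr_ge0.
  have -> : (k%:R - P%:R * m%:R) * s 0 i + m%:R * k%:R - P%:R * s 0 i ^+ 2 =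
    (s 0 i + m%:R) * (k%:R - P%:R * s 0 i) by ring.
  rewrite mulr_ge0 ?spectral_ge // subr_ge0 ltW //.
  have := small i; rewrite nk' /= real_leNgt ?negbK ?realn //.
  by rewrite rpredM ?realn ?spectral_real.
have : \sum_i P%:R * s 0 i ^+ 2 <= \sum_i ((k%:R - P%:R * m%:R) * s 0 i
    + m%:R * k%:R + (s 0 i == k%:R)%:R * ((P.-1 * k * (k + m))%:R)).
  by apply: ler_sum => i _.
rewrite -mulr_sumr (sum_spectral_sqr drg) !big_split /= -mulr_sumr.
rewrite (sum_spectral drg) mulr0 add0r sumr_const card_ord -mulr_suml.
have -> : \sum_i (s 0 i == k%:R)%:R = #|[pred j | s 0%R j == k%:R]|%:R :> algC.
  rewrite -sum1_card natr_sum [RHS]big_mkcond.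
  by apply: eq_bigr => j _; rewrite inE; case: eqP.
rewrite -natrM -[_ *+ n.+1]mulr_natr -!natrM -natrD ler_nat.
have := valency_eigenvalue_mult drg.
(* With n vertices and k of multiplicity 1, the sum reads (P - m) n <= (P - 1) (k + m). As k <= m^2
   n / (m^2 + 1) and P / (m^2 + 1) = 2 m, this forces n < P, against P < k < n. *)
move: #|_| nk Pk; rewrite /P; case=> [|[|//]]; nia.
Qed.

(** The s_j + m are nonnegative and, since tr A = 0, add up to m times the number of vertices; the
    copies of s_i alone contribute at least s_i times their number. *)
Lemma eigenvalue_mult_le P i : k%:R <= P%:R * s 0 i ->
  (k * #|[pred j | s 0%R j == s 0%R i]| <= P * m * n.+1)%N.
Proof.
move=> kP; set f := #|_|.
rewrite -(ler_nat algC) !natrM.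
have le1 : k%:R * f%:R <= P%:R * (s 0 i * f%:R).
  by rewrite mulrA ler_wpM2r ?ler0n.
apply: le_trans le1 _; rewrite -mulrA ler_wpM2l ?ler0n //.
have <- : \sum_j (s 0 j + m%:R) = m%:R * n.+1%:R :> algC.
  by rewrite big_split /= (sum_spectral drg) add0r sumr_const card_ord mulr_natr.
rewrite (bigID (fun j => s 0 j == s 0 i)) /= -[leLHS]addr0 lerD //; last first.
  by apply: sumr_ge0 => j _; apply: spectral_ge.
rewrite /f -sum1_card natr_sum mulr_sumr ler_sum // => j /eqP ->.
by rewrite mulr1 lerDl ler0n.
Qed.

(* A column of the idempotent [E] is determined by [rank E] of its entries, each
   taking at most [D + 1] values; adjacent vertices have distinct columns, so this
   is a proper colouring, whose classes meet a neighbourhood in cocliques. *)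
Lemma valency_le_colouring i : (1 < D)%N -> s 0 i != k%:R ->
  (k <= m ^ 2 * D.+1 ^ #|[pred j | s 0%R j == s 0%R i]|)%N.
Proof.
move=> D1 nk; have [E [h [hE EA h0 rkE _]]] := idempotent_radial drg i.
pose fn := maxrankfun E.
pose col (j : 'I_n.+1) : {ffun 'I_(\rank E) -> 'I_D.+1} :=
  [ffun a => inord (d (fn a) j)].
have colE j j' : col j = col j' -> forall x, E x j = E x j'.
  move=> ejj' x; have /submxP[W EW] : (E <= rowsub fn E)%MS.
    by rewrite eq_maxrowsub.
  rewrite EW !mxE; apply: eq_bigr => a _; rewrite !mxE !hE; congr (_ * h _).
  have /ffunP/(_ a) := ejj'; rewrite !ffunE => /(congr1 val) /=.
  by rewrite !inordK // ltnS (dist_max drg).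
have proper j j' : col j = col j' -> ~~ e j j'.
  (* Equal columns at adjacent vertices would give h 0 = h 1, hence the eigenvalue k by
     [radial_eigen1]. *)
  move=> /colE/(_ j); rewrite !hE (distxx drg) => h01; apply/negP.
  rewrite -(dist1 drg) => /eqP jj'; rewrite jj' in h01.
  have := radial_eigen1 drg hE EA; rewrite -h01 => /(mulIf h0) ks.
  by rewrite ks eqxx in nk.
rewrite -(valency drg ord0) -sum1_card (partition_big col predT) //=.
apply: leq_trans (_ : (\sum_(j : {ffun 'I_(\rank E) -> 'I_D.+1}) m ^ 2 <= _)%N).
  apply: leq_sum => v _; rewrite sum1dep_card.
  apply: (@coclique_le _ _ edgeC m ord0) => // [y|y z]; rewrite !inE.
    by case/andP.
  by move=> /andP[_ /eqP Ey] /andP[_ /eqP Ez]; apply: proper; rewrite Ey Ez.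
rewrite sum_nat_const card_ffun !card_ord mulnC leq_mul2l.
by rewrite leq_pexp2l ?orbT.
Qed.

(** The first summand covers k <= P. In the other case the exponent bounds the multiplicity f,
    because k f <= P m n and the number n of vertices is at most (D + 1) Q^D k. *)
Lemma valency_le_of_large_c2 Q : (1 < D)%N -> (0 < Q)%N ->
    ((m ^ 2 + 1) * k <= m ^ 2 * n.+1)%N -> (k <= Q * c 2)%N ->
  (k <= 2 * m * (m ^ 2 + 1) +
    m ^ 2 * D.+1 ^ (2 * m * (m ^ 2 + 1) * m * (D.+1 * Q ^ D)))%N.
Proof.
move=> D1 Q0 nk kQ; set P := (2 * m * _)%N; have [le|Pk] := leqP k P;
  first exact: leq_trans (leq_addr _ _).
have [i ni ki] := exists_large_eigenvalue Pk nk.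
have k0 : (0 < k)%N by apply: leq_ltn_trans Pk.
apply: leq_trans (valency_le_colouring D1 ni) (leq_trans _ (leq_addl _ _)).
rewrite leq_mul2l leq_pexp2l ?orbT // -(leq_pmul2l k0).
apply: leq_trans (eigenvalue_mult_le ki) _.
by rewrite mulnCA leq_mul2l [(k * _)%N]mulnC (card_le_valency drg) ?orbT.
Qed.

End LargeC2.

(** * The valency is at most [m^2 k_2] *)

Section SecondSphere.

Variables (n : nat) (e : rel 'I_n.+1) (d : 'I_n.+1 -> 'I_n.+1 -> nat).
Variables (D : nat) (b c : nat -> nat) (m : nat).
Hypothesis drg : drg_metric e d D b c.
Hypothesis m_gt0 : (0 < m)%N.
Hypothesis eig_ge : forall a : algC, eigenvalue (adj e) a -> - m%:R <= a.

Local Notation A := (adj e).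
Local Notation s := (spectral_diag A).
Local Notation k := (b 0%N).
Local Notation a1 := (inter_a b c 1).
Local Notation sphere x i := [set y | d x y == i].
Let edgeC := edge_sym drg.
Let eirr := edge_irr drg.

Lemma c2_le_valency : (1 < D)%N -> (c 2 <= k)%N.
Proof.
move=> D1; have [x [y E]] := dist_attained drg D1.
rewrite -(card_pred drg E) -(valency drg y); apply: subset_leq_card.
by apply/subsetP => z; rewrite !inE => /andP[].
Qed.

(** On a geodesic x, w, z, y of length 3, the common neighbours of w and y are neighbours of w at
    distance 2 from x. *)
Lemma c2_le_b1 : (2 < D)%N -> (c 2 <= b 1)%N.
Proof.
move=> D2; have [x [y E]] := dist_attained drg D2.
have [z eyz Ez] := dist_pred drg E; have [w ezw Ew] := dist_pred drg Ez.
have dwy : d w y = 2.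
  apply: (dist_eq2 drg (z := z)) => //; first by rewrite edgeC.
    by apply/eqP => wy; move: Ew; rewrite wy E.
  by apply/negP => /(dist_step drg x); rewrite E Ew.
rewrite -(card_pred drg dwy) -(card_succ drg Ew); apply: subset_leq_card.
apply/subsetP => u; rewrite !inE (dist1 drg) => /andP[eyu ewu]; rewrite ewu /=.
have := dist_step drg x ewu; move: eyu; rewrite edgeC => /(dist_step drg x).
by rewrite E Ew; lia.
Qed.

Lemma sphere12_le x : (k + #|sphere x 2| <= n.+1)%N.
Proof.
rewrite -(sphere1 drg x) -cardsUI -[X in (_ <= X)%N]card_ord.
rewrite [X in (_ + X)%N]eq_card0 ?addn0 ?max_card // => y.
by rewrite !inE; case: eqP => // ->.
Qed.

(** * Diameter two: strongly regular graphs *)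

Section DiameterTwo.

Hypothesis D2 : D = 2.

Let D1 : (1 < D)%N. Proof. by rewrite D2. Qed.

Lemma sphere2_card x : #|sphere x 2| = (n.+1 - 1 - k)%N.
Proof.
have := card_spheres drg x; rewrite D2 !big_ord_recl big_ord0 /=.
rewrite (sphere0 drg) (sphere1 drg) /bump /= -[(1 + (1 + 0))%N]/2%N.
by move: #|_| => K2; lia.
Qed.

Local Notation k2 := (n.+1 - 1 - k)%N.

Lemma k2_c2 : (k2 * c 2 = k * b 1)%N.
Proof.
by have := sphere_count drg ord0 1; rewrite sphere2_card (sphere1 drg).
Qed.

Lemma dist_gt1 x y : x != y -> ~~ e x y -> d x y = 2.
Proof.
move=> nxy ne; have := dist_max drg x y; move: nxy ne.
by rewrite -(dist0 drg) -(dist1 drg) D2; lia.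
Qed.

Lemma valency_gt0 : (0 < k)%N.
Proof. by apply: (b_gt0 drg); rewrite D2. Qed.

(* If [b_1 = k_2], the non-neighbours of [x] are adjacent to all neighbours of
   [x], so [x] and its non-neighbours form a component of the complement. *)
Lemma b1_lt_k2 : coconnected e -> (b 1 < k2)%N.
Proof.
move=> coco; pose x : 'I_n.+1 := ord0.
have sub y : e x y -> [set z | e y z & d x z == 2] \subset sphere x 2.
  by move=> _; apply/subsetP => z; rewrite !inE => /andP[].
have /card_gt0P[y0] : (0 < #|[set y | e x y]|)%N.
  by rewrite (valency drg) valency_gt0.
rewrite inE => exy0.
have d1 y : e x y -> d x y = 1%N by rewrite -(dist1 drg) => /eqP.
rewrite -(sphere2_card x) ltn_neqAle -{2}(card_succ drg (d1 _ exy0)).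
rewrite (subset_leq_card (sub _ exy0)) andbT; apply/negP => /eqP b1E.
have all_adj y z : e x y -> d x z = 2 -> e y z.
  move=> exy dz; have : z \in [set z | e y z & d x z == 2].
    have /eqP -> : [set z | e y z & d x z == 2] == sphere x 2.
      by rewrite eqEcard sub //= (card_succ drg (d1 _ exy)) b1E.
    by rewrite inE dz.
  by rewrite inE => /andP[].
have /connectP[p] := coco x y0; suff H u : (u == x) || (d x u == 2) ->
    path (fun u v => (u != v) && ~~ e u v) u p ->
    (last u p == x) || (d x (last u p) == 2).
  move=> /H; rewrite eqxx => /(_ isT) + E; rewrite -E (d1 _ exy0) orbF => /eqP yx.
  by move: exy0; rewrite yx eirr.
elim: p u => [//|v p IH] u ux /= /andP[/andP[nuv neuv] pp]; apply: IH pp.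
case: (v =P x) => //= /eqP nvx.
case/orP: ux => [/eqP ux|/eqP du].
  by rewrite dist_gt1 // -ux.
rewrite eq_sym in nvx; rewrite dist_gt1 //; apply: contra neuv => exv.
by rewrite edgeC all_adj.
Qed.

(** For z at distance 2 from x, the k - c_2 neighbours of z that are not adjacent to x lie, together
    with z itself, in the second sphere of x. *)
Lemma k_le_k2_c2 : (k < k2 + c 2)%N.
Proof.
have [x [z dxz]] := dist_attained drg D1.
have := cardsID [set y | e x y] [set y | e z y].
rewrite (valency drg) setIC (common_dist2 drg dxz).
suff : (#|[set y | e z y] :\: [set y | e x y]|.+1 <= k2)%N by lia.
have -> : #|[set y | e z y] :\: [set y | e x y]|.+1 =
    #|z |: ([set y | e z y] :\: [set y | e x y])|.
  by rewrite cardsU1 !inE eirr andbF.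
rewrite -(sphere2_card x); apply: subset_leq_card; apply/subsetP => y.
rewrite !inE => /orP[/eqP ->|/andP[nexy ezy]]; first by rewrite dxz.
rewrite dist_gt1 //; apply: contraTneq ezy => <-.
by rewrite edgeC -(dist1 drg) dxz.
Qed.

(** The quadratic of a strongly regular graph: A^2 = k + a_1 A + c_2 (J - 1 - A), with J the
    all-ones matrix, becomes p(A) = c_2 J. *)
Let p : {poly algC} :=
  'X^2 - (a1%:R - (c 2)%:R) *: 'X - (k%:R - (c 2)%:R)%:P.

Lemma adj_quadratic : horner_mx A p = const_mx (c 2)%:R.
Proof.
rewrite /p !rmorphB /= linearZ rmorphXn /= horner_mx_X !horner_mx_C.
apply/matrixP => x y; rewrite expr2 !mxE.
have -> : \sum_j A x j * A j y =
    #|[set z | e x z] :&: [set z | e y z]|%:R :> algC.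
  rewrite -sum1_card natr_sum [RHS]big_mkcond; apply: eq_bigr => z _.
  rewrite !mxE !inE [e z y]edgeC.
  by case: (e x z); case: (e y z); rewrite ?mulr1 ?mulr0.
have [<-|nxy] := eqVneq x y.
  by rewrite setIid (valency drg) eirr !mulr1n /=; ring.
rewrite !mulr0n !subr0; case exy: (e x y).
  by rewrite (common_edge drg exy) /=; ring.
by rewrite (common_dist2 drg) ?dist_gt1 ?exy //=; ring.
Qed.

(** Since J A = k J, the polynomial (X - k) p annihilates A. *)
Lemma spectral_quadratic i : s 0 i = k%:R \/ p.[s 0 i] = 0.
Proof.
have : horner_mx A (('X - k%:R%:P) * p) = horner_mx A 0.
  rewrite mulrC rmorphM rmorph0 /= adj_quadratic rmorphB /= horner_mx_X horner_mx_C.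
  apply/matrixP => x y; rewrite !mxE.
  rewrite (eq_bigr (fun z => (c 2)%:R * (A z y - k%:R *+ (z == y)))) => [|z _];
    last first.
    by rewrite !mxE.
  rewrite -mulr_sumr sumrB.
  have -> : \sum_z A z y = k%:R :> algC.
    rewrite -(valency drg y) -sum1_card natr_sum [RHS]big_mkcond.
    by apply: eq_bigr => z _; rewrite mxE inE edgeC; case: (e y z).
  rewrite (bigD1 y) //= eqxx big1 => [|z /negPf ->]; last by rewrite mulr0n.
  by rewrite addr0 mulr1n subrr mulr0.
move/(horner_eq_spectral edgeC i); rewrite hornerM horner0 => /eqP.
rewrite mulf_eq0 => /orP[|/eqP]; last by right.
by rewrite !hornerE subr_eq0 => /eqP; left.
Qed.

(* Were [p (- m) < 0], convexity and [p 0 <= 0] would put every root of [p] in the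
   spectrum on the nonnegative side, contradicting [tr A = 0]. *)
Lemma smallest_eig_quadratic : (m * b 1 + m.-1 * c 2 <= m.-1 * (k + m))%N.
Proof.
rewrite leqNgt; apply/negP => lt.
have pE t : p.[t] = t ^+ 2 - (a1%:R - (c 2)%:R) * t - (k%:R - (c 2)%:R).
  by rewrite /p !hornerE.
(* The claim is p(-m) >= 0: as a_1 = k - 1 - b_1, p(-m) = (m - 1) (k + m) - m b_1 - (m - 1) c_2. *)
have pm : p.[- m%:R] < 0.
  rewrite -(ltr_nat algC) -subr_gt0 in lt.
  rewrite -oppr_gt0; suff <- : ((m * b 1 + m.-1 * c 2)%N%:R - (m.-1 * (k + m))%N%:R : algC)
    = - p.[- m%:R] by [].
  rewrite pE.
  have a1E : a1%:R = k%:R - 1 - (b 1)%:R :> algC.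
    by rewrite (k_inter1 drg D1) -natr1 natrD; ring.
  rewrite a1E; have mE : m%:R = m.-1%:R + 1 :> algC by rewrite natr1 prednK.
  by rewrite natrD !natrM natrD mE; ring.
have p0 : k%:R - (c 2)%:R >= 0 :> algC by rewrite subr_ge0 ler_nat c2_le_valency.
have s_ge0 i : 0 <= s 0 i.
  have [->|ps] := spectral_quadratic i; first exact: ler0n.
  have sR := spectral_real drg eig_ge i; have sm := spectral_ge drg eig_ge i.
  rewrite real_leNgt ?real0 //; apply/negP => sneg.
  have mR : 0 < m%:R :> algC by rewrite ltr0n.
  (* Convexity as an identity: on [-m, 0] the value of p is its chord value minus (-s) (s + m). *)
  have E : m%:R * p.[s 0 i] = - ((- s 0 i) * (- p.[- m%:R])
      + (s 0 i + m%:R) * (k%:R - (c 2)%:R) + m%:R * (- s 0 i * (s 0 i + m%:R))).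
    rewrite !pE; ring.
  have : m%:R * p.[s 0 i] < 0.
    have ns : 0 < - s 0 i by rewrite oppr_gt0.
    rewrite E oppr_lt0 !ltr_wpDr ?mulr_ge0 ?(ltW mR) ?(ltW ns) //.
    by rewrite mulr_gt0 ?oppr_gt0.
  by rewrite ps mulr0 ltxx.
have s0 i : s 0 i = 0.
  have /eqP := sum_spectral drg; rewrite psumr_eq0 => [/allP/(_ i)|j _];
    last exact: s_ge0.
  by rewrite mem_index_enum /= => /(_ isT)/eqP.
have := sum_spectral_sqr drg; rewrite big1 => [/esym/eqP|i _]; last by rewrite s0 expr0n.
by rewrite pnatr_eq0 muln_eq0 /= eqn0Ngt valency_gt0.
Qed.

(** Put nu = k_2 - b_1 > 0 and r = k - c_2; then k_2 c_2 = k b_1 reads k nu = k_2 r. From r < b_1 +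
    nu and [smallest_eig_quadratic] follows b_1 <= (m - 1) (nu + m - 1), whence r <= k_2 <= m^2 nu
    and k nu <= m^2 nu k_2. *)
Lemma valency_le_k2 : coconnected e -> (k <= m ^ 2 * k2)%N.
Proof.
move=> /b1_lt_k2; have := smallest_eig_quadratic; have := k_le_k2_c2.
have := k2_c2; have := c2_le_valency D1.
move: (b 0%N) (b 1) (c 2) k2 => k B C K2 Ck e1 lt1 le2 lt3.
have [nu [K2E nu0]] : exists nu, K2 = (B + nu)%N /\ (0 < nu)%N.
  by exists (K2 - B)%N; split; lia.
have [r rE] : exists r, k = (C + r)%N by exists (k - C)%N; lia.
have knu : (k * nu = K2 * r)%N by nia.
have K2nu : (K2 <= m ^ 2 * nu)%N.
  case: m m_gt0 le2 => //= m' _ le2.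
  have h1 : (m'.+1 * B <= m' * (r + m'.+1))%N by nia.
  have h2 : (r < B + nu)%N by lia.
  have h3 : (B <= m' * (nu + m'))%N by nia.
  nia.
have rK : (r <= K2)%N by lia.
rewrite -(leq_pmul2r nu0) knu -mulnA [(K2 * nu)%N]mulnC mulnA [leqRHS]mulnC.
by rewrite leq_mul2l (leq_trans rK) ?orbT.
Qed.

End DiameterTwo.

(** For D >= 3, k_2 c_2 = k b_1 and c_2 <= b_1 give k <= k_2; for D = 2 there is [valency_le_k2].
    Both are combined with k + k_2 <= n, n being the number of vertices. *)
Lemma card_ge_valency : (1 < D)%N -> coconnected e ->
  ((m ^ 2 + 1) * k <= m ^ 2 * n.+1)%N.
Proof.
move=> D1 coco; rewrite leq_eqVlt in D1; have [D2|D3] := orP D1.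
  have := valency_le_k2 (esym (eqP D2)) coco; have := sphere12_le ord0.
  by rewrite (sphere2_card (esym (eqP D2))); move: (n.+1 - 1 - k)%N => K2; nia.
have := sphere12_le ord0; have := sphere_count drg ord0 1.
rewrite (sphere1 drg); have c20 := c2_gt0 drg (ltnW D3).
have := c2_le_b1 D3; move: #|_| => S2 cb SE.
have kS : (k <= S2)%N by rewrite -(leq_pmul2r c20) SE leq_mul2l cb orbT.
have := m_gt0; nia.
Qed.

End SecondSphere.

(** * Cliques in a neighbourhood *)

Section LocalCliques.
Local Open Scope nat_scope.

Variables (n : nat) (e : rel 'I_n) (d : 'I_n -> 'I_n -> nat).
Variables (D : nat) (b c : nat -> nat) (t : nat).
Hypothesis drg : drg_metric e d D b c.
Hypothesis t_gt0 : 0 < t.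
Hypothesis coclique_bound : forall x (S : {set 'I_n}),
  {in S, forall y, e x y} -> {in S &, forall y z, ~~ e y z} -> #|S| <= t.

Local Notation N x := [set y | e x y].
Local Notation a := (inter_a b c 1).
Local Notation mu := (c 2).
Hypothesis mu_gt0 : 0 < mu.
Hypothesis a_large : 10 * t ^ 2 * mu <= a.

Let edgeC := edge_sym drg.
Let eirr := edge_irr drg.

Let tmu_gt0 : 0 < t * mu. Proof. by rewrite muln_gt0 t_gt0. Qed.
Let tmu_le : t * mu <= t ^ 2 * mu. Proof. by rewrite leq_mul2r leq_pmulr ?orbT. Qed.

Variable x : 'I_n.

Lemma local_common u v : e x u -> e x v -> u != v -> ~~ e u v ->
  #|N u :&: N v| = mu.
Proof.
move=> xu xv nuv neuv; apply: (common_dist2 drg).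
exact: (dist_eq2 drg (z := x)).
Qed.

Definition local_coclique (S : {set 'I_n}) :=
  (S \subset N x) && [forall y in S, forall z in S, ~~ e y z].

Lemma local_coclique0 : local_coclique set0.
Proof. by rewrite /local_coclique sub0set; apply/forall_inP => y; rewrite inE. Qed.

(** The members of this coclique will index the lines through x. *)
Definition max_coclique := [arg max_(S > set0 | local_coclique S) #|S|].
Local Notation S := max_coclique.

Lemma max_coclique_nbr y : y \in S -> e x y.
Proof.
rewrite /S; case: arg_maxnP => [|T /andP[/subsetP sT _] _ /sT]; last by rewrite inE.
exact: local_coclique0.
Qed.

Lemma max_coclique_nonadj y z : y \in S -> z \in S -> ~~ e y z.
Proof.
rewrite /S; case: arg_maxnP => [|T /andP[_ /forall_inP H] _ yT zT].
  exact: local_coclique0.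
by have /forall_inP := H _ yT; apply.
Qed.

Lemma max_coclique_max T : local_coclique T -> #|T| <= #|S|.
Proof.
by rewrite /S; case: arg_maxnP => [|U _]; [exact: local_coclique0|apply].
Qed.

Lemma card_max_coclique : #|S| <= t.
Proof.
apply: (coclique_bound (x := x)); first exact: max_coclique_nbr.
by move=> y z; apply: max_coclique_nonadj.
Qed.

Lemma max_coclique_dom z : e x z -> exists2 y, y \in S & (z == y) || e y z.
Proof.
move=> xz; apply/exists_inP; apply: contraT; rewrite negb_exists_in => /forall_inP H.
have zS : z \notin S by apply/negP => /H; rewrite eqxx.
have := @max_coclique_max (z |: S); rewrite cardsU1 zS ltnn; apply.
apply/andP; split.
  apply/subsetP => y; rewrite !inE => /orP[/eqP ->//|]; exact: max_coclique_nbr.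
have nz y : y \in S -> ~~ e y z by move/H; rewrite negb_or => /andP[].
apply/forall_inP => u; rewrite !inE => uS; apply/forall_inP => v; rewrite !inE => vS.
case/orP: uS => [/eqP ->|uS]; case/orP: vS => [/eqP ->|vS].
- by rewrite eirr.
- by rewrite edgeC nz.
- by rewrite nz.
- exact: max_coclique_nonadj.
Qed.

(** A maximum coclique dominates the neighbourhood of x, and each member dominates a_1 + 1 vertices
    there. This turns a lower bound on k into one on a_1. *)
Lemma card_nbr_le : b 0 <= t * a.+1.
Proof.
rewrite -(valency drg x).
apply: leq_trans (_ : #|\bigcup_(y in S) (y |: (N x :&: N y))| <= _).
  apply: subset_leq_card; apply/subsetP => z; rewrite inE => xz.
  have [y yS yz] := max_coclique_dom xz.
  by apply/bigcupP; exists y => //; rewrite !inE xz.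
apply: leq_trans (card_bigcup_le (r := a.+1) _) _ => [y yS|].
  rewrite cardsU1 (common_edge drg) ?max_coclique_nbr //.
  by case: (_ \notin _); rewrite ?add1n ?add0n.
by rewrite leq_mul2r card_max_coclique orbT.
Qed.

(** The private neighbours of y: what y, and no other member of S, dominates. They form the core of
    a line through x and y. *)
Definition private y := [set z | [&& e x z, (z == y) || e y z &
  [forall y' in S, (y' != y) ==> ~~ e y' z]]].
Local Notation P := private.

Lemma private_nbr y z : z \in P y -> e x z.
Proof. by rewrite inE => /and3P[]. Qed.

Lemma private_dom y z : z \in P y -> (z == y) || e y z.
Proof. by rewrite inE => /and3P[]. Qed.

Lemma private_nonadj y y' z : z \in P y -> y' \in S -> y' != y -> ~~ e y' z.
Proof. by rewrite inE => /and3P[_ _ /forall_inP H] /H /implyP. Qed.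

(* Two non-adjacent elements of [private y] could replace [y] in [S]. *)
Lemma private_clique y z w : y \in S -> z \in P y -> w \in P y -> z != w -> e z w.
Proof.
move=> yS zP wP nzw; apply: contraT => nezw.
have nS u : u \in P y -> u \notin S :\ y.
  move=> uP; rewrite !inE; case: (u =P y) => //= /eqP nuy; apply/negP => uS.
  have := private_dom uP; rewrite (negPf nuy) /= => H.
  by have := max_coclique_nonadj yS uS; rewrite H.
have := @max_coclique_max (z |: (w |: S :\ y)).
rewrite !cardsU1 (negPf (nS w wP)) in_setU1 (negPf nzw) (negPf (nS z zP)) /=.
rewrite [#|S|](cardsD1 y) yS /= !add1n ltnn; apply.
have out u v : u \in P y -> v \in S :\ y -> ~~ e v u.
  by move=> uP; rewrite !inE => /andP[nvy vS]; apply: private_nonadj uP vS nvy.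
apply/andP; split.
  apply/subsetP => u; rewrite in_setU1 => /orP[/eqP ->|];
    first by rewrite inE (private_nbr zP).
  rewrite in_setU1 => /orP[/eqP ->|]; first by rewrite inE (private_nbr wP).
  by rewrite !inE => /andP[_]; apply: max_coclique_nbr.
apply/forall_inP => u uU; apply/forall_inP => v vU; move: uU vU.
rewrite !(in_setU1, in_setU1 _ w).
case/or3P=> [/eqP ->|/eqP ->|uS]; case/or3P=> [/eqP ->|/eqP ->|vS].
- by rewrite eirr.
- exact: nezw.
- by rewrite edgeC out.
- by rewrite edgeC.
- by rewrite eirr.
- by rewrite edgeC out.
- by rewrite out.
- by rewrite out.
by move: uS vS; rewrite !inE => /andP[_ uS] /andP[_ vS]; apply: max_coclique_nonadj.
Qed.

(** Of the a_1 + 1 vertices that y dominates, each other member of S, being at distance 2 from y,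
    removes at most mu. *)
Lemma card_private y : y \in S -> a.+1 <= #|P y| + t * mu.
Proof.
move=> yS; have xy := max_coclique_nbr yS.
have <- : #|y |: (N x :&: N y)| = a.+1.
  by rewrite cardsU1 (common_edge drg xy) !inE eirr andbF.
apply: leq_trans (_ : #|P y :|: \bigcup_(y' in S :\ y) (N y :&: N y')| <= _).
  apply: subset_leq_card; apply/subsetP => z zin.
  have xz : e x z by move: zin; rewrite !inE => /orP[/eqP ->//|/andP[]].
  have yz : (z == y) || e y z by move: zin; rewrite !inE => /orP[->//|/andP[_ ->]];
    rewrite orbT.
  rewrite in_setU; apply/orP.
  case: (boolP [forall y' in S, (y' != y) ==> ~~ e y' z]) => [H|].
    by left; rewrite inE xz yz.
  rewrite negb_forall_in => /exists_inP[y' y'S];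
    rewrite negb_imply negbK => /andP[ny ey'].
  right; apply/bigcupP; exists y'; first by rewrite !inE ny.
  rewrite !inE ey' andbT; case/orP: yz => [/eqP zy|//].
  by move: ey'; rewrite zy (negPf (max_coclique_nonadj _ _)).
apply: leq_trans (leq_card_setU _ _).1 _; rewrite leq_add2l.
apply: leq_trans (card_bigcup_le (r := mu) _) _ => [y'|].
  rewrite !inE => /andP[ny y'S]; rewrite local_common ?max_coclique_nbr //.
    by rewrite eq_sym.
  exact: max_coclique_nonadj.
rewrite leq_mul2r (leq_trans _ card_max_coclique) ?orbT //.
by apply: subset_leq_card; apply/subsetP => u; rewrite !inE => /andP[].
Qed.

(** A neighbour of x in no private set is adjacent to two members of S, which happens for at most
    t^2 mu vertices; the private sets, if each met X in at most mu elements, would account for t mu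
    more. *)
Lemma large_set_block (X : {set 'I_n}) :
    X \subset N x -> t ^ 2 * mu + t * mu < #|X| ->
  exists2 y, y \in S & mu < #|X :&: P y|.
Proof.
move=> /subsetP XN; rewrite ltnNge => H; apply/exists_inP; apply: contraNT H.
rewrite negb_exists_in => /forall_inP small.
pose R := \bigcup_(q in setX S S | q.1 != q.2) (N q.1 :&: N q.2).
apply: leq_trans (_ : #|R :|: \bigcup_(y in S) (X :&: P y)| <= _).
  apply: subset_leq_card; apply/subsetP => z zX; have := XN z zX; rewrite inE => xz.
  have [y yS yz] := max_coclique_dom xz; rewrite in_setU; apply/orP.
  case: (boolP (z \in P y)) => zP; [right|left].
    by apply/bigcupP; exists y => //; rewrite inE zX.
  move: zP; rewrite inE xz yz /= negb_forall_in => /exists_inP[y' y'S].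
  rewrite negb_imply negbK => /andP[ny ey'].
  apply/bigcupP; exists (y', y); first by rewrite !inE y'S yS.
  rewrite !inE ey' /=; case/orP: yz => [/eqP zy|//].
  by move: ey'; rewrite zy (negPf (max_coclique_nonadj _ _)).
apply: leq_trans (leq_card_setU _ _).1 (leq_add _ _).
  apply: leq_trans (card_bigcup_le (r := mu) _) _ => [[u v]|].
    rewrite !inE /= => /andP[/andP[uS vS] nuv].
    by rewrite local_common ?max_coclique_nbr ?max_coclique_nonadj.
  rewrite leq_mul2r -mulnn; apply/orP; right.
  apply: leq_trans (_ : #|setX S S| <= _).
    by apply: subset_leq_card; apply/subsetP => q /andP[].
  by rewrite cardsX leq_mul ?card_max_coclique.
apply: leq_trans (card_bigcup_le (r := mu) _) _ => [y yS|].
  by rewrite leqNgt small.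
by rewrite leq_mul2r card_max_coclique orbT.
Qed.

Definition attached z y := [forall p in P y, (p == z) || e p z].

Lemma attachedP z y p : attached z y -> p \in P y -> p != z -> e p z.
Proof. by move=> /forall_inP H /H /orP[->|]. Qed.

(** If p in P y were neither z nor adjacent to z, then p and z would be at distance 2, and the
    clique P y would put all of its neighbours of z among their mu common neighbours. *)
Lemma many_attached z y : e x z -> y \in S -> mu < #|N z :&: P y| -> attached z y.
Proof.
move=> xz yS H; apply/forall_inP => p pP; apply: contraLR H.
rewrite negb_or -leqNgt => /andP[npz nepz].
rewrite -(local_common (private_nbr pP) xz npz nepz); apply: subset_leq_card.
apply/subsetP => q; rewrite !inE => /andP[ezq qP]; rewrite ezq andbT.
apply: (private_clique yS pP); first by rewrite inE.
by apply: contraNneq nepz => ->; rewrite edgeC.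
Qed.

Lemma attached_ex z : e x z -> exists2 y, y \in S & attached z y.
Proof.
move=> xz; have [||y yS H] := @large_set_block (N x :&: N z).
- exact: subsetIl.
- rewrite (common_edge drg xz); nia.
exists y => //; apply: many_attached => //; apply: leq_trans H _.
by apply: subset_leq_card; rewrite setSI ?subsetIr.
Qed.

Lemma private_disjoint y y' : y \in S -> y' \in S -> y != y' -> P y :&: P y' = set0.
Proof.
move=> yS y'S ny; apply/setP => w; rewrite in_setI in_set0; apply/negP => /andP[wy wy'].
have := private_dom wy'; rewrite eq_sym in ny.
rewrite (negPf (private_nonadj wy y'S ny)) orbF => /eqP wE.
have := private_dom wy; rewrite wE (negPf ny) /=.
by rewrite (negPf (max_coclique_nonadj _ _)).
Qed.

(** Otherwise z is adjacent to two disjoint private sets, about 2 a_1 neighbours of x, while x and z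
    have only a_1 common neighbours. *)
Lemma attached_inj z y y' : e x z -> y \in S -> y' \in S ->
  attached z y -> attached z y' -> y = y'.
Proof.
move=> xz yS y'S ay ay'; apply/eqP; apply: contraT => ny.
have : #|(P y :|: P y') :\ z| <= #|N x :&: N z|.
  apply: subset_leq_card; apply/subsetP => w;
    rewrite in_setD1 in_setU in_setI ![w \in N _]inE.
  case/andP=> nwz /orP[] wP; rewrite (private_nbr wP) edgeC /=.
    exact: attachedP ay wP nwz.
  exact: attachedP ay' wP nwz.
rewrite (common_edge drg xz).
have := cardsD1 z (P y :|: P y'); rewrite cardsU private_disjoint // cards0.
have := card_private yS; have := card_private y'S.
case: (z \in _) => /=; nia.
Qed.

(** The default x is never reached when z is adjacent to x. *)
Definition block z := odflt x [pick y in S | attached z y].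

Lemma blockP z : e x z -> block z \in S /\ attached z (block z).
Proof.
move=> xz; rewrite /block; case: pickP => [y /andP[]//|H].
by have [y yS ay] := attached_ex xz; have := H y; rewrite /= yS ay.
Qed.

Lemma block_eq z y : e x z -> y \in S -> attached z y -> block z = y.
Proof.
by move=> xz yS ay; have [bS ab] := blockP xz; apply: (@attached_inj z).
Qed.

Lemma private_block y z : y \in S -> z \in P y -> block z = y.
Proof.
move=> yS zP; apply: (block_eq (private_nbr zP) yS); apply/forall_inP => p pP.
by case: (p =P z) => //= /eqP; apply: (private_clique yS pP zP).
Qed.

Lemma block_id y : y \in S -> block y = y.
Proof.
move=> yS; apply: private_block => //; rewrite inE max_coclique_nbr // eqxx /=.
by apply/forall_inP => y' y'S; apply/implyP => _; apply: max_coclique_nonadj.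
Qed.

(** Both vertices are attached to one large private clique, which then lies, up to u and v, in their
    common neighbourhood. With the converse [adj_block], equality of blocks becomes a condition
    symmetric in x, u and v, so lines do not depend on a base vertex. *)
Lemma block_adj u v : e x u -> e x v -> u != v -> block u = block v ->
  e u v /\ t ^ 2 * mu + t * mu < #|N x :&: N u :&: N v|.
Proof.
move=> xu xv nuv buv; have [yS au] := blockP xu; have [_ av] := blockP xv.
move: yS au av; rewrite -buv; move: (block u) => y yS au av.
have Py := card_private yS.
have sub w : w \in P y -> w != u -> w != v -> w \in N x :&: N u :&: N v.
  move=> wP nwu nwv; rewrite !inE (private_nbr wP) /= ![e _ w]edgeC.
  by rewrite (attachedP au) ?(attachedP av).
split.
  apply: contraT => neuv.
  have uP : u \notin P y by apply: contra neuv => uP; apply: attachedP av uP nuv.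
  have vP : v \notin P y.
    by apply: contra neuv => vP; rewrite edgeC; apply: attachedP au vP _; rewrite eq_sym.
  have : #|P y| <= #|N u :&: N v|.
    apply: subset_leq_card; apply/subsetP => w wP.
    have : w \in N x :&: N u :&: N v.
      by apply: sub => //; apply: contraTneq wP => ->.
    by rewrite !inE => /andP[/andP[_ ->] ->].
  rewrite (local_common xu xv nuv neuv) => le; nia.
have : #|P y :\ u :\ v| <= #|N x :&: N u :&: N v|.
  apply: subset_leq_card; apply/subsetP => w; rewrite !in_setD1 => /and3P[nwv nwu wP].
  exact: sub.
have := cardsD1 u (P y); have := cardsD1 v (P y :\ u).
have t_le := tmu_le; have t_gt := tmu_gt0.
move: a_large; rewrite -mulnA.
move: (t ^ 2 * mu) (t * mu) t_le t_gt Py => X Y.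
move: #|P y| #|P y :\ u| #|P y :\ u :\ v| #|N x :&: N u :&: N v| => p1 p2 p3 p4.
case: (u \in _); case: (v \in _) => /=; lia.
Qed.

(** The large common neighbourhood meets some P y in more than mu elements, which attaches both u
    and v to y. *)
Lemma adj_block u v : e x u -> e x v ->
  t ^ 2 * mu + t * mu < #|N x :&: N u :&: N v| -> block u = block v.
Proof.
move=> xu xv H; have [|y yS Hy] := large_set_block _ H.
  by rewrite -setIA subsetIl.
have att w : e x w -> N x :&: N u :&: N v \subset N w -> attached w y.
  move=> xw sw; apply: many_attached => //; apply: leq_trans Hy _.
  by apply: subset_leq_card; rewrite setSI.
rewrite !(block_eq (y := y)) // att // ?subsetIr //.
by rewrite setIAC subsetIr.
Qed.

Lemma card_block y : y \in S -> let B := [set z | e x z & block z == y] in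
  a.+1 <= #|B| + t * mu /\ #|B| <= a.+1.
Proof.
move=> yS B; split.
  apply: leq_trans (card_private yS) _; rewrite leq_add2r; apply: subset_leq_card.
  by apply/subsetP => z zP; rewrite inE (private_nbr zP) (private_block yS zP) eqxx.
apply: leq_trans (_ : #|y |: (N x :&: N y)| <= _); last first.
  rewrite cardsU1 (common_edge drg (max_coclique_nbr yS)).
  by case: (_ \notin _); rewrite ?add1n ?add0n.
apply: subset_leq_card; apply/subsetP => z; rewrite !inE => /andP[xz /eqP bz].
case: (z =P y) => //= /eqP nzy; rewrite xz /= edgeC.
have byz : block z = block y by rewrite bz block_id.
by have [] := block_adj xz (max_coclique_nbr yS) nzy byz.
Qed.

(** The blocks partition the neighbourhood of x, and each has between a_1 + 1 - t mu and a_1 + 1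
    elements. *)
Lemma valency_blocks : b 0 <= #|S| * a.+1 /\ #|S| * a.+1 <= b 0 + t ^ 2 * mu.
Proof.
have -> : b 0 = \sum_(y in S) #|[set z | e x z & block z == y]|.
  rewrite -(valency drg x) -sum1_card (partition_big block (mem S)) /= => [|z].
    by apply: eq_bigr => y _; rewrite sum1dep_card; apply: eq_card => z; rewrite !inE.
  by rewrite inE => /blockP[].
split; first by rewrite -sum_nat_const; apply: leq_sum => y /card_block[].
apply: leq_trans (_ : \sum_(y in S) (#|[set z | e x z & block z == y]| + t * mu) <= _).
  by rewrite -sum_nat_const; apply: leq_sum => y /card_block[].
rewrite big_split leq_add2l /= sum_nat_const -mulnn -mulnA.
by rewrite leq_mul2r card_max_coclique orbT.
Qed.

End LocalCliques.

(** * Lines *)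

Section Lines.
Local Open Scope nat_scope.

Variables (n : nat) (e : rel 'I_n) (d : 'I_n -> 'I_n -> nat).
Variables (D : nat) (b c : nat -> nat) (t : nat).
Hypothesis drg : drg_metric e d D b c.
Hypothesis t_gt0 : 0 < t.
Hypothesis coclique_bound : forall x (S : {set 'I_n}),
  {in S, forall y, e x y} -> {in S &, forall y z, ~~ e y z} -> #|S| <= t.

Local Notation N x := [set y | e x y].
Local Notation a := (inter_a b c 1).
Local Notation mu := (c 2).
Hypothesis mu_gt0 : 0 < mu.
Hypothesis a_large : 10 * t ^ 2 * mu <= a.

Let edgeC := edge_sym drg.
Let eirr := edge_irr drg.
Local Notation blk := (block e).

Definition near x y z := [&& e x y, e x z, e y z &
  t ^ 2 * mu + t * mu < #|N x :&: N y :&: N z|].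

Definition line x y := [set z | [|| z == x, z == y | near x y z]].

Lemma near_block x y z : e x y -> z != y -> near x y z = e x z && (blk x z == blk x y).
Proof.
move=> xy nzy; rewrite /near xy /=; case xz: (e x z) => //=.
rewrite eq_sym in nzy.
apply/andP/eqP => [[_ H]|E];
  first by rewrite (adj_block drg t_gt0 coclique_bound mu_gt0 a_large xy xz H).
by apply: (block_adj drg t_gt0 coclique_bound mu_gt0 a_large xy xz nzy); rewrite E.
Qed.

Lemma nearC x y z : near x y z = near y x z.
Proof.
rewrite /near [e y x]edgeC [N y :&: N x]setIC.
by case: (e x y); case: (e x z); case: (e y z).
Qed.

Lemma lineC x y : line x y = line y x.
Proof. by apply/setP => z; rewrite !inE nearC orbCA. Qed.

Lemma in_line x y z : e x y -> z \in line x y = (z == x) || (e x z && (blk x z == blk x y)).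
Proof.
move=> xy; rewrite inE; case: (z =P x) => //= _.
case: (z =P y) => [->|/eqP nzy]; first by rewrite xy eqxx.
exact: near_block.
Qed.

Lemma line_left x y : x \in line x y. Proof. by rewrite inE eqxx. Qed.
Lemma line_right x y : y \in line x y. Proof. by rewrite inE eqxx orbT. Qed.

Lemma line_from x y z : e x y -> z \in line x y -> z != x -> e x z /\ line x z = line x y.
Proof.
move=> xy; rewrite in_line // => /orP[->//|/andP[xz /eqP bz]] _; split=> //.
by apply/setP => w; rewrite !in_line // bz.
Qed.

(** Exchanges one base point at a time: [line_from] replaces y, and [lineC] makes x replaceable in
    turn. *)
Lemma line_two x y u v : e x y -> u \in line x y -> v \in line x y -> u != v ->
  e u v /\ line u v = line x y.
Proof.
move=> xy ul vl nuv; have [ux|nux] := eqVneq u x.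
  by rewrite ux in nuv *; apply: line_from => //; rewrite eq_sym.
have [xu lxu] := line_from xy ul nux; rewrite -lxu lineC in vl *.
by apply: line_from; rewrite 1?edgeC // eq_sym.
Qed.

Definition lines : {set {set 'I_n}} :=
  [set line q.1 q.2 | q in [set q | e q.1 q.2]].

Lemma linesP L : reflect (exists x y, e x y /\ L = line x y) (L \in lines).
Proof.
apply: (iffP imsetP) => [[[x y]]|[x [y [xy ->]]]]; first by rewrite inE => xy ->;
  exists x, y.
by exists (x, y) => //; rewrite inE.
Qed.

Lemma lines_clique L : L \in lines -> clique e L.
Proof.
by move=> /linesP[x [y [xy ->]]] u v ul vl nuv; have [] := line_two xy ul vl nuv.
Qed.

Lemma lines_through2 u v : u != v ->
  #|[set L in lines | (u \in L) && (v \in L)]| = e u v.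
Proof.
move=> nuv; case uv: (e u v); last first.
  apply: eq_card0 => L; rewrite !inE; apply/negP => /andP[Ll /andP[uL vL]].
  by move: uv; rewrite (lines_clique Ll).
rewrite -[RHS](cards1 (line u v)); congr #|pred_of_set _|; apply/setP => L.
rewrite !inE; apply/idP/eqP => [/andP[/linesP[x [y [xy ->]]] /andP[ul vl]]|->].
  by have [_ ->] := line_two xy ul vl nuv.
rewrite line_left line_right !andbT; apply/linesP; by exists u, v.
Qed.

(** The map sending y to [line x y] is a bijection from the maximum coclique to the lines on x,
    since each member of the coclique is its own block. *)
Lemma lines_through1 x : #|[set L in lines | x \in L]| = #|max_coclique e x|.
Proof.
set S := max_coclique e x.
have nbr y : y \in S -> e x y by apply: max_coclique_nbr.
rewrite -(@card_in_imset _ _ (line x) (mem S)); last first.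
  move=> y y' yS y'S E; have := line_right x y'; rewrite -E in_line ?nbr //.
  rewrite !(block_id drg t_gt0 coclique_bound mu_gt0 a_large) //.
  case/orP=> [/eqP yx|/andP[_ /eqP]//].
  by have := nbr _ y'S; rewrite yx eirr.
apply: eq_card => L; rewrite inE; apply/andP/imsetP => [[/linesP[u [v [uv ->]]] xL]|].
  have [w [wL nwx]] : exists w, w \in line u v /\ w != x.
    have [ux|nux] := eqVneq u x; last by exists u; rewrite line_left.
    exists v; rewrite line_right; split=> //.
    by apply: contraTneq uv => ->; rewrite ux eirr.
  rewrite eq_sym in nwx.
  have [xw <-] := line_two uv xL wL nwx.
  have [bS _] := blockP drg t_gt0 coclique_bound mu_gt0 a_large xw.
  have xb := nbr _ bS; exists (blk x w) => //; apply/setP => z; rewrite !in_line //.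
  by rewrite [blk x (blk x w)](block_id drg t_gt0 coclique_bound mu_gt0 a_large).
case=> y yS ->; rewrite line_left; split=> //.
by apply/linesP; exists x, y; rewrite nbr.
Qed.

Lemma card_line_gt L : L \in lines -> t < #|L|.
Proof.
move=> /linesP[x [y [xy ->]]].
have [bS _] := blockP drg t_gt0 coclique_bound mu_gt0 a_large xy.
have [le _] := card_block drg t_gt0 coclique_bound mu_gt0 a_large bS.
have : #|[set z | e x z & blk x z == blk x y]| <= #|line x y|.
  by apply: subset_leq_card; apply/subsetP => z; rewrite in_line // inE => ->;
    rewrite orbT.
have h1 : t * mu <= t ^ 2 * mu by rewrite leq_mul2r leq_pmulr ?orbT.
have h2 : t <= t * mu by rewrite leq_pmulr.
move: a_large le; rewrite -mulnA; move: (t ^ 2 * mu) (t * mu) h1 h2 => X Y h1 h2.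
move: #|_| #|_| => p q; lia.
Qed.

(* By [valency_blocks] the number of lines through a vertex is [k / (a_1 + 1)]
   rounded up. *)
Lemma card_max_coclique_const x y : #|max_coclique e x| = #|max_coclique e y|.
Proof.
wlog suff le : x y / #|max_coclique e x| <= #|max_coclique e y|.
  by apply/eqP; rewrite eqn_leq !le.
have [_ le1] := valency_blocks drg t_gt0 coclique_bound mu_gt0 a_large x.
have [le2 _] := valency_blocks drg t_gt0 coclique_bound mu_gt0 a_large y.
rewrite leqNgt; apply/negP => lt.
have : #|max_coclique e y|.+1 * a.+1 <= #|max_coclique e x| * a.+1 by rewrite leq_mul2r lt orbT.
rewrite mulSn; move: a_large; rewrite -mulnA.
move: le1 le2; move: (_ * a.+1) (_ * a.+1) (t ^ 2 * mu) => p q X; lia.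
Qed.

End Lines.

(** * Partial linear spaces and Delsarte cliques *)

Section Geometric.

Variables (n : nat) (e : rel 'I_n.+1) (d : 'I_n.+1 -> 'I_n.+1 -> nat).
Variables (D : nat) (b c : nat -> nat).
Hypothesis drg : drg_metric e d D b c.
Hypothesis D1 : (1 < D)%N.

Local Notation A := (adj e).
Local Notation s := (spectral_diag A).
Local Notation k := (b 0%N).
Let edgeC := edge_sym drg.
Let eirr := edge_irr drg.

(* A partial linear space on the vertices whose collinearity graph is the given one,
   with [M] lines of more than [M] points on every vertex. *)
Variables (Ls : {set {set 'I_n.+1}}) (M : nat).
Hypothesis Ls_through2 : forall u v, u != v ->
  #|[set L in Ls | (u \in L) && (v \in L)]| = e u v.
Hypothesis Ls_through1 : forall x, #|[set L in Ls | x \in L]| = M.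
Hypothesis Ls_size : forall L, L \in Ls -> (M < #|L|)%N.

Let Inc : 'M[algC]_(n.+1, #|Ls|) := 
  \matrix_(x, i) (x \in (enum_val i : {set 'I_n.+1}))%:R.

Lemma incidence_gram : Inc *m Inc^T = A + M%:R%:M.
Proof.
apply/matrixP => x y; rewrite !mxE.
transitivity (#|[set L in Ls | (x \in L) && (y \in L)]|%:R : algC).
  rewrite -[in RHS]sum1_card natr_sum.
  rewrite [RHS](eq_bigl (fun L => (L \in Ls) && ((x \in L) && (y \in L)))) => [|L].
    2: by rewrite inE.
  rewrite [RHS]big_mkcondr [RHS]big_enum_val /=; apply: eq_bigr => i _; rewrite !mxE.
  by case: (x \in _); case: (y \in _); rewrite ?mulr1 ?mulr0.
have [<-|nxy] := eqVneq x y; last by rewrite Ls_through2 // mulr0n addr0.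
rewrite eirr add0r mulr1n -(Ls_through1 x); congr (_%:R).
by apply: eq_card => L; rewrite !inE andbb.
Qed.

(** Counting incident pairs gives n M >= (M + 1) |Ls| for n vertices. Hence [Inc] has a nonzero left
    kernel. *)
Lemma card_lines_lt : (#|Ls| < n.+1)%N.
Proof.
have H : (n.+1 * M = \sum_(L in Ls) #|L|)%N.
  transitivity (\sum_(x : 'I_n.+1) \sum_(L in Ls) (x \in L : nat))%N.
    rewrite -[X in (X * _)%N](card_ord n.+1) -sum_nat_const.
    apply: eq_bigr => x _; rewrite -(Ls_through1 x) -sum1_card.
    rewrite (eq_bigl (fun L => (L \in Ls) && (x \in L))) => [|L]; last by rewrite inE.
    by rewrite big_mkcondr; apply: eq_bigr => L _; case: (x \in L).
  rewrite exchange_big /=; apply: eq_bigr => L _.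
  by rewrite -sum1_card [RHS]big_mkcond; apply: eq_bigr => x _; case: (x \in L).
have : (#|Ls| * M.+1 <= n.+1 * M)%N.
  by rewrite H -sum_nat_const; apply: leq_sum => L /Ls_size.
have [->|/card_gt0P[L LL]] := posnP #|Ls|; first by [].
rewrite -(ltn_pmul2r (_ : 0 < M.+1)%N) // => /leq_ltn_trans; apply.
by rewrite ltn_mul2l /= ltnSn.
Qed.

(** W Inc Inc^T = 0, so the rows of W Inc have norm 0. *)
Lemma left_kernel_incidence p (W : 'M[algC]_(p, n.+1)) : W *m A = - M%:R *: W ->
  W *m Inc = 0.
Proof.
move=> WA; have WI : W *m Inc *m Inc^T = 0.
  by rewrite -mulmxA incidence_gram mulmxDr WA mul_mx_scalar scaleNr addNr.
have IC : map_mx Num.conj Inc = Inc by apply/matrixP => x y; rewrite !mxE conjC_nat.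
apply/matrixP => x i; rewrite [RHS]mxE.
have : ((W *m Inc) *m (map_mx Num.conj (W *m Inc))^T) x x = 0.
  by rewrite map_mxM IC trmx_mul mulmxA WI mul0mx mxE.
rewrite mxE => /eqP; rewrite psumr_eq0 => [/allP/(_ i)|j _]; last first.
  by rewrite [_^T _ _]mxE [map_mx _ _ _ _]mxE -normCK exprn_ge0.
rewrite mem_index_enum => /(_ isT) /=.
by rewrite [_^T _ _]mxE [map_mx _ _ _ _]mxE -normCK expf_eq0 normr_eq0 => /eqP.
Qed.

(** The left kernel of [Inc] realises - M; for an eigenvector v with eigenvalue a, |v Inc|^2 = (a +
    M) |v|^2 gives a >= - M. *)
Lemma smallest_eig_lines : smallest_eig e (- M%:R).
Proof.
split.
  have : kermx Inc != 0.
    rewrite -mxrank_eq0 mxrank_ker subn_eq0 -ltnNge.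
    exact: leq_ltn_trans (rank_leq_col _) card_lines_lt.
  case/rowV0Pn => v /sub_kermxP vI nv; apply/eigenvalueP; exists v => //.
  have : v *m (A + M%:R%:M) = 0 by rewrite -incidence_gram mulmxA vI mul0mx.
  by rewrite mulmxDr mul_mx_scalar => /eqP; rewrite addr_eq0 -scaleNr => /eqP.
move=> a /eigenvalueP[v va nv].
have IC : map_mx Num.conj Inc = Inc by apply/matrixP => x y; rewrite !mxE conjC_nat.
pose w := v *m Inc.
have E : (w *m (map_mx Num.conj w)^T) 0 0 = (a + M%:R) * (v *m (map_mx Num.conj v)^T) 0 0.
  rewrite /w map_mxM IC trmx_mul mulmxA -[v *m _ *m _]mulmxA incidence_gram.
  by rewrite mulmxDr va mul_mx_scalar -scalerDl -scalemxAl mxE.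
have sq p (u : 'rV[algC]_p) : (u *m (map_mx Num.conj u)^T) 0 0 = \sum_j `|u 0 j| ^+ 2.
  by rewrite mxE; apply: eq_bigr => j _; rewrite !mxE -normCK.
have v0 : 0 < \sum_j `|v 0 j| ^+ 2.
  rewrite lt_def sumr_ge0 => [|j _]; last by rewrite exprn_ge0.
  rewrite andbT psumr_eq0 => [|j _]; last by rewrite exprn_ge0.
  apply: contra nv => /allP H; apply/eqP/rowP => j; rewrite mxE.
  by have := H j; rewrite mem_index_enum expf_eq0 normr_eq0 => /(_ isT)/eqP.
rewrite !sq in E.
have : 0 <= (a + M%:R) * \sum_j `|v 0 j| ^+ 2.
  by rewrite -E sumr_ge0 // => j _; rewrite exprn_ge0.
by rewrite pmulr_lge0 // -{1}[M%:R]opprK subr_ge0.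
Qed.

(** For x on L, row x of the idempotent of - M is orthogonal to L, that is h(0) + (|L| - 1) h(1) =
    0, while k h(1) = - M h(0). *)
Lemma lines_delsarte L : L \in Ls -> #|L|%:R = 1 + k%:R / (- - M%:R) :> algC.
Proof.
move=> LL; rewrite opprK; have k0 : (0 < k)%N by apply: (b_gt0 drg); apply: ltnW.
have [x xL] : exists x, x \in L.
  by apply/card_gt0P; apply: leq_ltn_trans (Ls_size LL).
have M0 : M%:R != 0 :> algC.
  rewrite pnatr_eq0 -lt0n -(Ls_through1 x) card_gt0; apply/set0Pn; exists L.
  by rewrite inE LL.
(* If - M were absent from the spectral diagonal, A + M would be invertible. *)
have [i /eqP iM] : exists i, s 0 i == - M%:R.
  have [eM _] := smallest_eig_lines.
  apply/existsP; apply: contraT; rewrite negb_exists => /forallP H.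
  have /eigenvalueP[v vA nv] := eM.
  have : horner_mx A ('X + M%:R%:P) \in unitmx.
    rewrite horner_spectral // !unitmx_mul unitmx_inv spectral_unit andbT /=.
    rewrite unitmxE det_diag unitfE; apply/prodf_neq0 => j _.
    by rewrite mxE !hornerE addr_eq0 H.
  move/mulmxK/(_ v); rewrite rmorphD /= horner_mx_X horner_mx_C.
  rewrite mulmxDr vA mul_mx_scalar scaleNr addNr mul0mx => v0.
  by rewrite -v0 eqxx in nv.
have [E [h [hE EA h0 _ _]]] := idempotent_radial drg i.
rewrite iM in EA.
have h1 := radial_eigen1 drg hE EA.
have EI := left_kernel_incidence EA.
have LE : enum_val (enum_rank_in LL L) = L by rewrite enum_rankK_in.
have /matrixP/(_ x (enum_rank_in LL L)) := EI; rewrite !mxE.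
rewrite (bigD1 x) //= [Inc x _]mxE LE xL mulr1 hE (distxx drg).
have -> : \sum_(y | y != x) E x y * Inc y (enum_rank_in LL L) = (#|L|%:R - 1) * h 1%N.
  transitivity (\sum_(y in L :\ x) h 1%N : algC).
    rewrite [RHS]big_mkcond [LHS]big_mkcond; apply: eq_bigr => y _.
    rewrite in_setD1 [Inc _ _]mxE LE; case nyx: (y == x) => //=.
    case yL: (y \in L); rewrite ?mulr0 // mulr1 hE; congr h.
    apply/eqP; rewrite (dist1 drg); have nxy : x != y by rewrite eq_sym nyx.
    have := Ls_through2 nxy; case: (e x y) => // /eqP;
      rewrite cards_eq0 => /eqP/setP/(_ L).
    by rewrite !inE LL xL yL.
  rewrite sumr_const [in RHS](cardsD1 x L) xL natrD [in RHS]addrAC subrr add0r.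
  by rewrite mulr_natl.
have kR : k%:R != 0 :> algC by rewrite pnatr_eq0 -lt0n.
move=> H; have : k%:R * h 0%N + (#|L|%:R - 1) * (k%:R * h 1%N) = 0.
  by rewrite mulrCA -mulrDr H mulr0.
rewrite h1 mulrCA mulrA [_ * h 0%N]mulrC.
have -> : h 0%N * k%:R + (- M%:R * (#|L|%:R - 1)) * h 0%N =
  h 0%N * (k%:R - M%:R * (#|L|%:R - 1)) by ring.
move/eqP; rewrite mulf_eq0 (negPf h0) /= subr_eq0 => /eqP ->.
by rewrite mulrC mulKf // addrC subrK.
Qed.

Lemma geometric_lines : geometric e.
Proof.
exists k, (- M%:R); split; [|split; first exact: smallest_eig_lines].
  by move=> x; rewrite (valency drg).
exists Ls; split=> [L LL|x y xy]; last first.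
  rewrite Ls_through2 ?xy //; apply: contraTneq xy => ->; by rewrite eirr.
split; last exact: lines_delsarte.
move=> u v uL vL nuv; have := Ls_through2 nuv; case: (e u v) => // /eqP.
by rewrite cards_eq0 => /eqP/setP/(_ L); rewrite !inE LL uL vL.
Qed.

End Geometric.

(** * Finiteness *)

Lemma In_map (T : eqType) (U : Type) (f : T -> U) (r : seq T) x :
  x \in r -> List.In (f x) (map f r).
Proof.
elim: r => //= y r IH; rewrite inE => /orP[/eqP ->|/IH]; [by left|by right].
Qed.

Lemma In_flatten (T : Type) (rr : seq (seq T)) r x :
  List.In r rr -> List.In x r -> List.In x (flatten rr).
Proof.
elim: rr => //= r' rr IH [->|rin] xin; apply/List.in_or_app; first by left.
by right; apply: IH.
Qed.

(** Boolean tables on pairs of vertices form a finite type and represent every relation up to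
    pointwise equality, so the identity serves as isomorphism. *)
Lemma finitely_many_graphs B : exists L : seq {n : nat & rel 'I_n},
  forall n (e : rel 'I_n), (n <= B)%N ->
    exists G, List.In G L /\ graph_iso e (projT2 G).
Proof.
pose graph n (f : {ffun 'I_n * 'I_n -> bool}) : {n : nat & rel 'I_n} :=
  existT _ n (fun x y => f (x, y)).
pose graphs n := map (@graph n) (enum {ffun 'I_n * 'I_n -> bool}).
exists (flatten (map graphs (iota 0 B.+1))) => n e nB.
pose f := [ffun q : 'I_n * 'I_n => e q.1 q.2].
exists (graph n f); split.
  apply: (@In_flatten _ _ (graphs n)); first by apply: In_map; rewrite mem_iota.
  by apply: In_map; rewrite mem_enum.
exists id; split; first by exists id.
by move=> x y; rewrite /= ffunE.
Qed.

Lemma geometric_of_small_c2 n (e : rel 'I_n.+1) d D b c m :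
    drg_metric e d D b c -> (0 < m)%N -> (1 < D)%N ->
    (forall a : algC, eigenvalue (adj e) a -> - m%:R <= a) ->
    (10 * (m ^ 2) ^ 3 * c 2 < b 0)%N ->
  geometric e.
Proof.
move=> drg m0 D1 eig lt; set t := (m ^ 2)%N in lt *.
have t0 : (0 < t)%N by rewrite expn_gt0 m0.
have mu0 := c2_gt0 drg D1.
have coc x (S : {set 'I_n.+1}) : {in S, forall y, e x y} ->
    {in S &, forall y z, ~~ e y z} -> (#|S| <= t)%N.
  exact: (coclique_le (edge_sym drg) m0 (edge_irr drg) eig).
(* This fixes the power of t in the hypothesis: 10 t^3 c_2 < k <= t (a_1 + 1). *)
have a_large : (10 * t ^ 2 * c 2 <= inter_a b c 1)%N.
  rewrite -ltnS -(ltn_pmul2l t0); apply: leq_trans (card_nbr_le drg coc ord0).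
  by apply: leq_trans lt; rewrite ltnS expnSr; nia.
apply: (geometric_lines drg D1 (Ls := lines e c t) (M := #|max_coclique e ord0|)).
- by move=> u v; apply: (lines_through2 drg).
- move=> x; rewrite (lines_through1 drg) //.
  exact: (card_max_coclique_const drg t0 coc mu0 a_large).
move=> L /(card_line_gt drg t0 coc mu0 a_large); apply: leq_ltn_trans.
exact: card_max_coclique.
Qed.

Theorem theorem1p2 (m D : nat) : (2 <= m)%N -> (2 <= D)%N ->
  exists L : seq {n : nat & rel 'I_n},
    forall (n : nat) (e : rel 'I_n),
      simple_graph e -> coconnected e -> drg_diam e D -> ~ geometric e ->
      (forall a : algC, eigenvalue (adj e) a -> - (m%:R) <= a) ->
      exists G, List.In G L /\ graph_iso e (projT2 G).
Proof.
move=> m2 D2; have m0 : (0 < m)%N by apply: ltnW.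
(* [Q] is the threshold of [geometric_of_small_c2], and [K] the bound of [valency_le_of_large_c2]
   for it. *)
pose Q := (10 * (m ^ 2) ^ 3)%N.
pose K := (2 * m * (m ^ 2 + 1) +
  m ^ 2 * D.+1 ^ (2 * m * (m ^ 2 + 1) * m * (D.+1 * Q ^ D)))%N.
have [L HL] := finitely_many_graphs (K.+1 ^ D).
(* The spectral lemmas require a vertex; the graph on no vertices is covered by the list
   directly. *)
exists L => -[|n] e simple coco drg ngeo eig; first by apply: HL.
have [d [b [c dm]]] := drg_diam_metric simple drg.
apply: HL; apply: (card_le_pow dm).
have Q0 : (0 < Q)%N by rewrite muln_gt0 !expn_gt0 m0.
have [le|lt] := leqP (b 0%N) (Q * c 2).
  exact: (valency_le_of_large_c2 dm m0 eig D2 Q0 (card_ge_valency dm m0 eig D2 coco)).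
by case: ngeo; apply: (geometric_of_small_c2 dm m0 D2 eig).
Qed.
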